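(* Let $\Gamma$ be a finite, free, EI-category which is skeletal, i.e. two isomorphic objects are already equal. Then $\Gamma$ is of type (FP$_{\mathbb{C}}$) and of type ($L^2$), and has an Euler characteristic in the sense of Leinster. For the $L^2$-Euler characteristic $\chi^{(2)}(\Gamma)$ and Leinster's Euler characteristic $\chi_L(\Gamma)$ we have $$\chi^{(2)}(\Gamma)=\chi_L(\Gamma).$$
   Context: A small category $\Gamma$ is finite if it has finitely many isomorphism classes of objects and all morphism sets are finite; EI if every endomorphism is an isomorphism; free if for all objects $x,y$ the left $\mathrm{aut}(y)$-action on $\mathrm{mor}(x,y)$ is free. Leinster's Euler characteristic: a weighting on a finite category $\Gamma$ is a function $k^\bullet\colon\mathrm{ob}(\Gamma)\to\mathbb{Q}$ with $\sum_{y\in\mathrm{ob}(\Gamma)}|\mathrm{mor}(x,y)|\cdot k^y=1$ for all objects $x$; a coweighting $k_\bullet$ on $\Gamma$ is a weighting on $\Gamma^{op}$. $\Gamma$ has an Euler characteristic in the sense of Leinster if it has both a weighting and a coweighting; then $\chi_L(\Gamma):=\sum_yk^y=\sum_xk_x$, independent of choices. A $\mathbb{C}\Gamma$-module is a functor $\Gamma^{op}\to\mathbb{C}\text{-Mod}$ (exactness objectwise). Projective: direct summand of a direct sum of modules $\mathbb{C}\,\mathrm{mor}(?,x)$; finitely generated projective: the sum can be taken finite. $\Gamma$ is of type (FP$_{\mathbb{C}}$) if the constant module $\underline{\mathbb{C}}$ has a resolution with finitely many nonzero terms, all finitely generated projective. $\mathbb{C}[x]=\mathbb{C}[\mathrm{aut}(x)]$.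 $S_xM$ is the right $\mathbb{C}[x]$-module obtained as the quotient of $M(x)$ by the submodule generated by the images of all $M(u)$, $u\colon x\to y$ a non-isomorphism. $\mathcal{N}(x)$ is the group von Neumann algebra of $\mathrm{aut}(x)$, with (L\''uck) dimension $\dim_{\mathcal{N}(x)}$; for finite $\mathrm{aut}(x)$, $\mathcal{N}(x)=\mathbb{C}[x]$ and $\dim_{\mathcal{N}(x)}(M)=\dim_{\mathbb{C}}(M)/|\mathrm{aut}(x)|$. $\Gamma$ is of type ($L^2$) if for a projective $\mathbb{C}\Gamma$-resolution $P_*$ of $\underline{\mathbb{C}}$, $\sum_{\overline{x}\in\mathrm{iso}(\Gamma)}\sum_p\dim_{\mathcal{N}(x)}H_p(S_xP_*\otimes_{\mathbb{C}[x]}\mathcal{N}(x))<\infty$, where $\mathrm{iso}(\Gamma)$ is the set of isomorphism classes of objects; then $\chi^{(2)}(\Gamma):=\sum_{\overline{x}}\sum_p(-1)^p\dim_{\mathcal{N}(x)}H_p(S_xP_*\otimes_{\mathbb{C}[x]}\mathcal{N}(x))$. *)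

(* Defs.v *)
From HB Require Import structures.
From mathcomp Require Import all_boot all_order all_algebra.
From mathcomp Require Import all_classical all_reals all_analysis.
From mathcomp Require Import finmap complex freeg.

Set Implicit Arguments.
Unset Strict Implicit.
Unset Printing Implicit Defensive.

Import Order.TTheory GRing.Theory Num.Theory.

Local Open Scope classical_set_scope.
Local Open Scope ring_scope.
Local Open Scope quotient_scope.

(* The choiceType structures lose no generality: classically every type carries
   one (gen_eqMixin, gen_choiceMixin). *)
Record category := Category {
  ob :> choiceType;
  hom : ob -> ob -> choiceType;
  idm : forall x, hom x x;
  hcomp : forall x y z, hom y z -> hom x y -> hom x z;
  hcomp1f : forall x y (f : hom x y), hcomp (idm y) f = f;
  hcompf1 : forall x y (f : hom x y), hcomp f (idm x) = f;
  hcompA : forall x y z t (h : hom z t) (g : hom y z) (f : hom x y),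
    hcomp h (hcomp g f) = hcomp (hcomp h g) f }.

Arguments hom {c} x y.
Arguments idm {c} x.
Arguments hcomp {c x y z} g f.

Definition opcat (G : category) : category :=
  @Category (ob G) (fun x y => hom y x) (fun x => idm x)
    (fun x y z g f => hcomp f g)
    (fun x y f => hcompf1 f) (fun x y f => hcomp1f f)
    (fun x y z t h g f => esym (hcompA f g h)).

Section Category.
Variable G : category.
Implicit Types x y z : G.

Definition is_iso x y (f : hom x y) : Prop :=
  exists g : hom y x, hcomp g f = idm x /\ hcomp f g = idm y.

Lemma is_iso_id x : is_iso (idm x).
Proof. by exists (idm x); rewrite hcomp1f. Qed.

Lemma is_iso_comp x y z (g : hom y z) (f : hom x y) :
  is_iso g -> is_iso f -> is_iso (hcomp g f).
Proof.
move=> [g' [g'g gg']] [f' [f'f ff']]; exists (hcomp f' g'); split.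
  by rewrite hcompA -(hcompA f') g'g hcompf1.
by rewrite hcompA -(hcompA g) ff' hcompf1.
Qed.

Definition aut x : choiceType := {g : hom x x | `[< is_iso g >]}.

Lemma aut_comp_subproof x (g h : aut x) : `[< is_iso (hcomp (sval g) (sval h)) >].
Proof.
by apply/asboolP/is_iso_comp; apply/asboolP; [exact: svalP g|exact: svalP h].
Qed.

Definition aut_comp x (g h : aut x) : aut x :=
  exist _ (hcomp (sval g) (sval h)) (aut_comp_subproof g h).

Definition isomorphic x y : bool := `[< exists f : hom x y, is_iso f >].

Lemma isomorphic_equiv : equiv_class_of isomorphic.
Proof.
have sym x y : isomorphic x y -> isomorphic y x.
  by move=> /asboolP[f [g [gf fg]]]; apply/asboolP; exists g, f.
split=> [x|x y|y x z].
- by apply/asboolP; exists (idm x); exact: is_iso_id.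
- by apply/idP/idP; exact: sym.
- move=> /asboolP[f f_iso] /asboolP[g g_iso].
  by apply/asboolP; exists (hcomp g f); exact: is_iso_comp.
Qed.

Canonical isomorphic_eqrel := EquivRelPack isomorphic_equiv.

End Category.

Definition iso_class (G : category) : quotType G := {eq_quot @isomorphic G}.

Definition finite_cat (G : category) : Prop :=
  finite_set [set: iso_class G] /\
  forall x y : G, finite_set [set: hom x y].

Definition EI_cat (G : category) : Prop :=
  forall (x : G) (f : hom x x), is_iso f.

Definition free_cat (G : category) : Prop :=
  forall (x y : G) (f : hom x y) (a : aut y),
    hcomp (sval a) f = f -> sval a = idm y.

Definition skeletal (G : category) : Prop :=
  forall x y : G, (exists f : hom x y, is_iso f) -> x = y.

(* The number of elements of T when T is finite (0 otherwise). *)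
Definition ncard (T : choiceType) : nat := #|` fset_set [set: T]|.

(* The sum over objects is a sum over the support, i.e. a genuine finite sum
   as soon as there are finitely many objects. *)
Definition weighting (G : category) (k : G -> rat) : Prop :=
  forall x : G, \sum_(y \in [set: G]) (ncard (hom x y))%:R * k y = 1.

Definition coweighting (G : category) (k : G -> rat) : Prop :=
  @weighting (opcat G) k.

Definition has_chiL (G : category) : Prop :=
  (exists k, @weighting G k) /\ (exists k, @coweighting G k).

(* Total by convention: 0 when there is no weighting or no coweighting. *)
Definition chiL (G : category) : rat :=
  xget 0 [set c | exists k l, [/\ @weighting G k, @coweighting G l,
    c = \sum_(y \in [set: G]) k y & c = \sum_(x \in [set: G]) l x]].

Section LinearSpan.
Variables (K : fieldType) (V : lmodType K) (X : set V).

Inductive in_span : V -> Prop :=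
| in_span_gen v : X v -> in_span v
| in_span0 : in_span 0
| in_spanD v w : in_span v -> in_span w -> in_span (v + w)
| in_spanZ c v : in_span v -> in_span (c *: v).

Definition span_pred : {pred V} := fun v => `[< in_span v >].

Lemma span_predP v : reflect (in_span v) (v \in span_pred).
Proof. exact: asboolP. Qed.

Lemma span_pred_closed : submod_closed span_pred.
Proof.
split=> [|c v w /span_predP vX /span_predP wX]; apply/span_predP.
  exact: in_span0.
by apply: in_spanD => //; exact: in_spanZ.
Qed.
HB.instance Definition _ := GRing.isSubmodClosed.Build K V span_pred
  span_pred_closed.

(* The quotient of V by the linear span of X. *)
Definition quotlm := Quotient.quot span_pred.
HB.instance Definition _ := GRing.Zmodule.on quotlm.
HB.instance Definition _ := EqQuotient.on quotlm.

Definition qpi (v : V) : quotlm := \pi_quotlm v.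

Lemma qpi_eq v w : (qpi v = qpi w) <-> in_span (v - w).
Proof.
split=> [/eqP|/span_predP vw].
  by rewrite /qpi -Quotient.idealrBE => /span_predP.
by apply/eqP; rewrite /qpi -Quotient.idealrBE.
Qed.

Lemma qpiK (q : quotlm) : qpi (repr q) = q.
Proof. exact: reprK. Qed.

Lemma qpiD v w : qpi (v + w) = qpi v + qpi w.
Proof. by rewrite /qpi !piE. Qed.

Definition qscale (c : K) (q : quotlm) : quotlm := qpi (c *: repr q).

Lemma qpiZ c v : qpi (c *: v) = qscale c (qpi v).
Proof.
apply/qpi_eq; rewrite -scalerBr; apply: in_spanZ.
by apply/qpi_eq; rewrite qpiK.
Qed.

Lemma qscaleA c d q : qscale c (qscale d q) = qscale (c * d) q.
Proof. by rewrite -[q]qpiK -!qpiZ scalerA. Qed.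
Lemma qscale1 q : qscale 1 q = q.
Proof. by rewrite -[q]qpiK -qpiZ scale1r. Qed.
Lemma qscaleDr : right_distributive qscale +%R.
Proof.
by move=> c q r; rewrite -[q]qpiK -[r]qpiK -qpiD -!qpiZ scalerDr qpiD.
Qed.
Lemma qscaleDl q : {morph qscale^~ q : c d / c + d}.
Proof. by move=> c d; rewrite -[q]qpiK -!qpiZ scalerDl qpiD. Qed.

HB.instance Definition _ := GRing.Zmodule_isLmodule.Build K quotlm
  qscaleA qscale1 qscaleDr qscaleDl.

Lemma qpi_is_linear : linear qpi.
Proof. by move=> c v w; rewrite qpiD qpiZ. Qed.
HB.instance Definition _ := GRing.isLinear.Build K V quotlm _ qpi qpi_is_linear.

End LinearSpan.

Section QuotientMap.
Variables (K : fieldType) (V W : lmodType K) (X : set V) (Y : set W).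
Variables (f : {linear V -> W}) (fXY : forall v, X v -> in_span Y (f v)).

Lemma in_span_lin v : in_span X v -> in_span Y (f v).
Proof.
elim=> [{}v /fXY//||{}v w _ fv _ fw|c {}v _ fv].
- by rewrite linear0; exact: in_span0.
- by rewrite linearD; exact: in_spanD.
- by rewrite linearZ; exact: in_spanZ.
Qed.

Definition qmap (q : quotlm X) : quotlm Y := qpi Y (f (repr q)).

Lemma qmapE v : qmap (qpi X v) = qpi Y (f v).
Proof.
apply/qpi_eq; rewrite -linearB; apply: in_span_lin.
by apply/qpi_eq; rewrite qpiK.
Qed.

Lemma qmap_is_linear : linear qmap.
Proof.
by move=> c q r; rewrite -[q]qpiK -[r]qpiK -linearP !qmapE !linearP.
Qed.

Definition qlin : {linear quotlm X -> quotlm Y} :=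
  HB.pack qmap (GRing.isLinear.Build K _ _ _ qmap qmap_is_linear).

Lemma qlinE v : qlin (qpi X v) = qpi Y (f v).
Proof. exact: qmapE. Qed.

End QuotientMap.

(* External direct sum: finitely supported families. *)
Section DirectSum.
Variables (K : fieldType) (I : Type) (V : I -> lmodType K).

Record dsum := DSum {
  dsum_fun :> forall i, V i;
  dsum_finite : finite_set [set i | dsum_fun i <> 0] }.

HB.instance Definition _ := gen_eqMixin dsum.
HB.instance Definition _ := gen_choiceMixin dsum.

Lemma dsum_ext (v w : dsum) : (forall i, v i = w i) -> v = w.
Proof.
case: v w => [v v_fin] [w w_fin] /= vw.
have {}vw : v = w by exact: functional_extensionality_dep.
by subst w; congr DSum; exact: Prop_irrelevance.
Qed.

Lemma dsum0_subproof : finite_set [set i | (0 : V i) <> 0].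
Proof. by apply: sub_finite_set (finite_set0 I) => i /=. Qed.
Definition dsum0 := DSum dsum0_subproof.

Lemma dsumN_subproof (v : dsum) : finite_set [set i | - v i <> 0].
Proof.
apply: sub_finite_set (dsum_finite v) => i /= + vi0.
by rewrite vi0 oppr0.
Qed.
Definition dsumN v := DSum (dsumN_subproof v).

Lemma dsumD_subproof (v w : dsum) : finite_set [set i | v i + w i <> 0].
Proof.
have vw : finite_set ([set i | v i <> 0] `|` [set i | w i <> 0]).
  by rewrite finite_setU; split; exact: dsum_finite.
apply: sub_finite_set vw => i /= vwi.
have [v0|/eqP] := eqVneq (v i) 0; last by left.
by right=> w0; apply: vwi; rewrite v0 w0 addr0.
Qed.
Definition dsumD v w := DSum (dsumD_subproof v w).

Lemma dsumZ_subproof c (v : dsum) : finite_set [set i | c *: v i <> 0].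
Proof.
apply: sub_finite_set (dsum_finite v) => i /= + vi0.
by rewrite vi0 scaler0.
Qed.
Definition dsumZ c v := DSum (dsumZ_subproof c v).

Lemma dsumDA : associative dsumD.
Proof. by move=> u v w; apply: dsum_ext => i /=; rewrite addrA. Qed.
Lemma dsumDC : commutative dsumD.
Proof. by move=> v w; apply: dsum_ext => i /=; rewrite addrC. Qed.
Lemma dsum0D : left_id dsum0 dsumD.
Proof. by move=> v; apply: dsum_ext => i /=; rewrite add0r. Qed.
Lemma dsumND : left_inverse dsum0 dsumN dsumD.
Proof. by move=> v; apply: dsum_ext => i /=; rewrite addNr. Qed.
HB.instance Definition _ := GRing.isZmodule.Build dsum dsumDA dsumDC dsum0D dsumND.

Lemma dsumZA c d v : dsumZ c (dsumZ d v) = dsumZ (c * d) v.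
Proof. by apply: dsum_ext => i /=; rewrite scalerA. Qed.
Lemma dsumZ1 v : dsumZ 1 v = v.
Proof. by apply: dsum_ext => i /=; rewrite scale1r. Qed.
Lemma dsumZDr : right_distributive dsumZ +%R.
Proof. by move=> c v w; apply: dsum_ext => i /=; rewrite scalerDr. Qed.
Lemma dsumZDl v : {morph dsumZ^~ v : c d / c + d}.
Proof. by move=> c d; apply: dsum_ext => i /=; rewrite scalerDl. Qed.
HB.instance Definition _ := GRing.Zmodule_isLmodule.Build K dsum
  dsumZA dsumZ1 dsumZDr dsumZDl.

End DirectSum.

Section DirectSumMap.
Variables (K : fieldType) (I : Type) (V W : I -> lmodType K).
Variable f : forall i, {linear V i -> W i}.

Lemma dsum_map_subproof (v : dsum V) : finite_set [set i | f i (v i) <> 0].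
Proof.
apply: sub_finite_set (dsum_finite v) => i /= + vi0.
by rewrite vi0 linear0.
Qed.
Definition dsum_map (v : dsum V) : dsum W := DSum (dsum_map_subproof v).

Lemma dsum_map_is_linear : linear dsum_map.
Proof. by move=> c v w; apply: dsum_ext => i; rewrite /= linearP. Qed.
HB.instance Definition _ := GRing.isLinear.Build K (dsum V) (dsum W) _ dsum_map
  dsum_map_is_linear.
End DirectSumMap.

Section FreeLmod.
Variables (K : fieldType) (S : choiceType) (V : lmodType K) (f : S -> V).

HB.instance Definition _ := GRing.isAdditive.Build {freeg S / K} V (fglift f)
  (lift_is_additive f).

Lemma fglift_is_scalable : scalable (fglift f : {freeg S / K} -> V).
Proof.
move=> c D; rewrite /= -[in RHS](freeg_sumE D) [in RHS]raddf_sum scaler_sumr.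
rewrite -[LHS]/(fglift f (fgscale c D)) /fgscale raddf_sum.
by apply: eq_bigr => x _; rewrite /= !liftU scalerA.
Qed.
HB.instance Definition _ := 
  GRing.isScalable.Build K {freeg S / K} V _ (fglift f) fglift_is_scalable.
End FreeLmod.

Definition freeg_map (K : fieldType) (S T : choiceType) (f : S -> T) :
  {linear {freeg S / K} -> {freeg T / K}} :=
  fglift (fun s => << f s >> : {freeg T / K}).

Lemma freeg_mapU (K : fieldType) (S T : choiceType) (f : S -> T) (s : S) :
  freeg_map K f << s >> = << f s >>.
Proof. by rewrite /freeg_map /= liftU scale1r. Qed.

Lemma freeg_linear_ext (K : fieldType) (S : choiceType) (V : lmodType K)
    (f g : {linear {freeg S / K} -> V}) :
  (forall s, f << s >> = g << s >>) -> f =1 g.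
Proof.
move=> fg D; rewrite -(freeg_sumE D) !linear_sum; apply: eq_bigr => s _.
have -> : << coeff s D *g s >> = coeff s D *: << s >> :> {freeg S / K}.
  by apply/eqP/freeg_eqP => t; rewrite coeffZ !coeffU mul1r.
by rewrite !linearZ_LR fg.
Qed.

Section Homology.
Variables (K : fieldType) (C : nat -> lmodType K).
Variable d : forall p, {linear C p.+1 -> C p}.

Definition is_cycle (p : nat) : {pred C p} :=
  match p with
  | 0%N => fun=> true
  | q.+1 => fun v => d q v == 0
  end.

Lemma is_cycle_closed p : submod_closed (@is_cycle p).
Proof.
case: p => [//|p]; split=> [|c v w]; first by rewrite unfold_in linear0.
by rewrite !unfold_in => /eqP dv /eqP dw; rewrite linearP dv dw scaler0 addr0.
Qed.
HB.instance Definition _ p := GRing.isSubmodClosed.Build K (C p) (@is_cycle p)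
  (@is_cycle_closed p).

Definition cycles p := {v : C p | v \in @is_cycle p}.
HB.instance Definition _ p := SubChoice.on (cycles p).
HB.instance Definition _ p := [SubChoice_isSubLmodule of cycles p by <:].

(* H_p = ker (C_p -> C_(p-1)) / im (C_(p+1) -> C_p), where C_(-1) = 0. *)
Definition homology (p : nat) : lmodType K :=
  quotlm [set z : cycles p | exists c : C p.+1, val z = d p c].

End Homology.

(* M (x)_(K[A]) N for a right K[A]-module M and a left K[A]-module N, both given
   by the actions of the elements of A. *)
Section Tensor.
Variables (K : fieldType) (A : Type).

Section Def.
Variables (M N : lmodType K) (actM : A -> M -> M) (actN : A -> N -> N).
Local Notation "m ⊗ n" := (<< (m, n) >> : {freeg (M * N)%type / K}) (at level 40).

Inductive tensor_rel : set {freeg (M * N)%type / K} :=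
| tensor_relDl m m' n : tensor_rel ((m + m') ⊗ n - m ⊗ n - m' ⊗ n)
| tensor_relDr m n n' : tensor_rel (m ⊗ (n + n') - m ⊗ n - m ⊗ n')
| tensor_relZl c m n : tensor_rel ((c *: m) ⊗ n - c *: (m ⊗ n))
| tensor_relZr c m n : tensor_rel (m ⊗ (c *: n) - c *: (m ⊗ n))
| tensor_rel_act a m n : tensor_rel (actM a m ⊗ n - m ⊗ actN a n).

Definition tensor : lmodType K := quotlm tensor_rel.

End Def.

Section Map.
Variables (M M' N : lmodType K).
Variables (actM : A -> M -> M) (actM' : A -> M' -> M') (actN : A -> N -> N).
Variable f : {linear M -> M'}.
Hypothesis f_act : forall a m, f (actM a m) = actM' a (f m).

Let free_map :=
  (freeg_map K (fun mn : M * N => (f mn.1, mn.2) : M' * N)).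

Lemma tensor_map_subproof t :
  tensor_rel actM actN t -> in_span (tensor_rel actM' actN) (free_map t).
Proof.
case=> [m m' n|m n n'|c m n|c m n|a m n]; apply: in_span_gen.
- by rewrite !linearB !freeg_mapU linearD; exact: tensor_relDl.
- by rewrite !linearB !freeg_mapU; exact: tensor_relDr.
- by rewrite linearB linearZ_LR !freeg_mapU linearZ_LR; exact: tensor_relZl.
- by rewrite linearB linearZ_LR !freeg_mapU; exact: tensor_relZr.
- by rewrite linearB !freeg_mapU f_act; exact: tensor_rel_act.
Qed.

Definition tensor_map : {linear tensor actM actN -> tensor actM' actN} :=
  qlin tensor_map_subproof.

End Map.
End Tensor.

Section Dimension.
Variables (K : fieldType) (R : realType) (V : lmodType K).

Definition is_basis n (b : 'I_n -> V) : Prop :=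
  forall v, exists! c : {ffun 'I_n -> K}, v = \sum_(i < n) c i *: b i.

(* The size of a basis, +oo if there is no finite one. *)
Definition dimE : \bar R :=
  xget +oo%E [set n%:R%:E | n in [set n | exists b : 'I_n -> V, is_basis b]].

End Dimension.

Section Modules.
Variables (K : fieldType) (G : category).

Record cmod := CMod {
  cmod_ob :> G -> lmodType K;
  cmod_map : forall x y, hom x y -> {linear cmod_ob y -> cmod_ob x};
  cmod_map_id : forall x v, cmod_map (idm x) v = v;
  cmod_map_comp : forall x y z (g : hom y z) (f : hom x y) v,
    cmod_map (hcomp g f) v = cmod_map f (cmod_map g v) }.

Record cmod_hom (M N : cmod) := CModHom {
  cmod_hom_fun :> forall x, {linear M x -> N x};
  cmod_hom_nat : forall x y (f : hom x y) v,
    cmod_hom_fun x (cmod_map M f v) = cmod_map N f (cmod_hom_fun y v) }.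

Definition cmod_iso (M N : cmod) : Prop :=
  exists (f : cmod_hom M N) (g : cmod_hom N M),
    forall x, cancel (f x) (g x) /\ cancel (g x) (f x).

Definition const_cmod : cmod :=
  @CMod (fun=> K^o) (fun _ _ _ => idfun) (fun _ _ => erefl)
    (fun _ _ _ _ _ _ => erefl).

(* The module K mor(?,x). *)
Section Representable.
Variable x : G.
Let M (y : G) : lmodType K := {freeg (hom y x) / K}.
Let M_map (y z : G) (f : hom y z) : {linear M z -> M y} :=
  freeg_map K (fun u : hom z x => hcomp u f).

Let M_map_id y v : M_map (idm y) v = v.
Proof.
move: v; apply: (freeg_linear_ext (g := idfun)) => u.
by rewrite freeg_mapU hcompf1.
Qed.

Let M_map_comp y z t (g : hom z t) (f : hom y z) v :
  M_map (hcomp g f) v = M_map f (M_map g v).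
Proof.
move: v; apply: (freeg_linear_ext (g := M_map f \o M_map g)) => u.
by rewrite /= !freeg_mapU hcompA.
Qed.

Definition repr_cmod : cmod := CMod M_map_id M_map_comp.
End Representable.

Section Sums.
Variables (I : Type) (M : I -> cmod).

Let S (x : G) : lmodType K := dsum (fun i => M i x).
Let S_map (x y : G) (f : hom x y) : {linear S y -> S x} :=
  dsum_map (fun i => cmod_map (M i) f).
Let S_map_id x v : S_map (idm x) v = v.
Proof. by apply: dsum_ext => i; exact: cmod_map_id. Qed.
Let S_map_comp x y z (g : hom y z) (f : hom x y) v :
  S_map (hcomp g f) v = S_map f (S_map g v).
Proof. by apply: dsum_ext => i; exact: cmod_map_comp. Qed.

Definition cmod_dsum : cmod := CMod S_map_id S_map_comp.
End Sums.

Definition cmod_sum2 (M N : cmod) : cmod :=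
  cmod_dsum (fun b : bool => if b then M else N).

Definition projective (P : cmod) : Prop :=
  exists (I : Type) (x : I -> G) (Q : cmod),
    cmod_iso (cmod_sum2 P Q) (cmod_dsum (fun i => repr_cmod (x i))).

Definition fg_projective (P : cmod) : Prop :=
  exists (n : nat) (x : 'I_n -> G) (Q : cmod),
    cmod_iso (cmod_sum2 P Q) (cmod_dsum (fun i => repr_cmod (x i))).

(* A resolution ... -> P_1 -> P_0 -> M -> 0, exact at every object. *)
Record resolution (M : cmod) := Resolution {
  res :> nat -> cmod;
  res_d : forall p, cmod_hom (res p.+1) (res p);
  res_aug : cmod_hom (res 0%N) M;
  res_aug_surj : forall x (v : M x), exists u, res_aug x u = v;
  res_exact0 : forall x (u : res 0%N x),
    res_aug x u = 0 <-> exists w, res_d 0%N x w = u;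
  res_exactS : forall p x (u : res p.+1 x),
    res_d p x u = 0 <-> exists w, res_d p.+1 x w = u }.

Definition projective_resolution M (P : resolution M) : Prop :=
  forall p, projective (P p).

Definition type_FP : Prop :=
  exists P : resolution const_cmod,
    (forall p, fg_projective (P p)) /\
    exists n, forall p x, (n <= p)%N -> forall v : P p x, v = 0.

Section Splitting.
Variable x : G.

(* The K[x]-submodule generated by these elements v is the linear span of the
   elements v . a with a in aut(x). *)
Definition noniso_image (M : cmod) : set (M x) :=
  [set v | exists (y : G) (u : hom x y) (w : M y) (a : aut x),
    ~ is_iso u /\ v = cmod_map M (sval a) (cmod_map M u w)].

Definition S_ob (M : cmod) : lmodType K := quotlm (@noniso_image M).

Lemma S_act_subproof (M : cmod) (a : aut x) v :
  @noniso_image M v -> in_span (@noniso_image M) (cmod_map M (sval a) v).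
Proof.
move=> [y [u [w [b [u_niso ->]]]]]; apply: in_span_gen.
by exists y, u, w, (aut_comp b a); rewrite /= cmod_map_comp.
Qed.

Definition S_act (M : cmod) (a : aut x) : {linear S_ob M -> S_ob M} :=
  qlin (@S_act_subproof M a).

Lemma S_map_subproof (M N : cmod) (f : cmod_hom M N) v :
  @noniso_image M v -> in_span (@noniso_image N) (f x v).
Proof.
move=> [y [u [w [a [u_niso ->]]]]]; apply: in_span_gen.
by exists y, u, (f y w), a; rewrite !cmod_hom_nat.
Qed.

Definition S_map (M N : cmod) (f : cmod_hom M N) : {linear S_ob M -> S_ob N} :=
  qlin (S_map_subproof f).

Lemma S_map_act (M N : cmod) (f : cmod_hom M N) (a : aut x) v :
  S_map f (S_act M a v) = S_act N a (S_map f v).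
Proof. by rewrite -[v]qpiK !qlinE cmod_hom_nat. Qed.

(* For finite aut(x), the group von Neumann algebra N(x) is K[x] (with K the
   complex numbers); aut(x) acts on it by left multiplication. *)
Definition vN_algebra : lmodType K := {freeg (aut x) / K}.

Definition vN_act (a : aut x) : {linear vN_algebra -> vN_algebra} :=
  freeg_map K (aut_comp a).

Definition S_tensor (M : cmod) : lmodType K :=
  tensor (fun a => S_act M a) (fun a => vN_act a).

Definition S_tensor_map (M N : cmod) (f : cmod_hom M N) :
    {linear S_tensor M -> S_tensor N} :=
  tensor_map (fun a => vN_act a) (S_map_act f).

End Splitting.

Section L2.
Variable R : realType.

(* The von Neumann dimension when aut(x) is finite: dim_K V / |aut(x)|, with
   values in [0, +oo]. It is meaningless for infinite aut(x), and so are the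
   definitions below. *)
Definition dim_vN (x : G) (V : lmodType K) : \bar R :=
  (dimE R V * ((ncard (aut x))%:R^-1)%:E)%E.

(* dim_N(x) H_p(S_x P (x)_(K[x]) N(x)) *)
Definition L2_betti M (P : resolution M) (x : G) (p : nat) : \bar R :=
  dim_vN x (homology (fun p => S_tensor_map x (res_d P p)) p).

(* The sum over the isomorphism classes of objects, each class contributing
   the term of a representative. *)
Definition L2_sum M (P : resolution M) : \bar R :=
  (\esum_(c in [set: iso_class G]) \esum_(p in [set: nat])
    L2_betti P (repr c) p)%E.

Definition type_L2 : Prop :=
  exists P : resolution const_cmod, projective_resolution P /\
    (L2_sum P < +oo)%E.

(* Sum of an absolutely summable family of real numbers. *)
Definition abs_sum (T : choiceType) (a : T -> R) : R :=
  fine (\esum_(t in [set: T]) (Num.max (a t) 0)%:E)%E -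
  fine (\esum_(t in [set: T]) (Num.max (- a t) 0)%:E)%E.

Definition L2_alt_sum M (P : resolution M) : R :=
  abs_sum (fun c : iso_class G =>
    abs_sum (fun p : nat => (-1) ^+ p * fine (L2_betti P (repr c) p))).

(* Total by convention: 0 when G is not of type (L2). *)
Definition chi2 : R :=
  xget 0 [set c | exists P : resolution const_cmod,
    [/\ projective_resolution P, (L2_sum P < +oo)%E & c = L2_alt_sum P]].

End L2.
End Modules.

(* Main.v *)
Require Import Defs.
From HB Require Import structures.
From mathcomp Require Import all_boot all_order all_algebra.
From mathcomp Require Import all_classical all_reals all_analysis.
From mathcomp Require Import finmap complex freeg zify ring lra.
Import Defs.
Set Implicit Arguments.
Unset Strict Implicit.
Unset Printing Implicit Defensive.
Import Order.TTheory GRing.Theory Num.Theory.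
Local Open Scope classical_set_scope.
Local Open Scope ring_scope.

(** Let P be any projective resolution of the constant module. For each object x the
    space P_p(x) is filtered by the images of the arrows out of x, and freeness
    of the category makes the graded pieces |mor(x,y)|/|aut(y)| copies of S_y P_p for
    each y, compatibly with the differentials ([arrow_list], [detects_projective]).
    The complex P(x) has homology K in degree 0 only. Going down from the maximal
    objects, the long exact sequences of the filtration ([euler_ext], [euler_quot])
    show that each complex S_x P has finite-dimensional total homology, and comparing
    Euler characteristics in P(x) gives

      1 = sum over y of |mor(x,y)| chi(S_y P) / |aut(y)|   for all x

    ([euler_objects]). Thus y |-> chi(S_y P)/|aut(y)| is a weighting. Since the group
    algebra of the finite group aut(y) is its own von Neumann algebra, the number
    chi(S_y P)/|aut(y)| is also the contribution of y to the L2-Euler characteristic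
    ([betti_euler]), so this Euler characteristic computed from P is the sum of a
    weighting, whichever P is used ([L2_any_resolution]). A coweighting exists because
    the matrix of the numbers |mor(x,y)| is triangular with nonzero diagonal
    ([zeta_inj]).

    It remains to find a finite resolution by finitely generated projectives. A
    finite-dimensional module M is covered by the sum over x of the modules
    M(x) (x) K mor(?,x) over the group algebra of aut(x), modelled here as equivariant
    families of elements of the M(x). In characteristic 0, averaging over aut(x) makes
    this a retract of a finite sum of representables ([ind_fg_projective]). The
    cover is injective at the maximal objects of the support of M ([counit_inj]), so
    the syzygies vanish after as many steps as there are objects ([syzygy_vanish],
    [finite_type_FP]). *)

(** * Dimension of a subquotient *)

Section RelativeDimension.
Variable K : fieldType.

Definition subspace (V : lmodType K) (X : set V) :=
  X 0 /\ forall c v w, X v -> X w -> X (c *: v + w).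

Section SubspaceTheory.
Variables (V : lmodType K) (X : set V).
Hypothesis subX : subspace X.

Lemma subspace0 : X 0. Proof. exact: subX.1. Qed.

Lemma subspaceZ c v : X v -> X (c *: v).
Proof. by move=> Xv; rewrite -[_ *: _]addr0; apply: subX.2 => //; exact: subX.1. Qed.

Lemma subspaceD v w : X v -> X w -> X (v + w).
Proof. by move=> Xv Xw; rewrite -[v]scale1r; apply: subX.2. Qed.

Lemma subspaceN v : X v -> X (- v).
Proof. by move=> Xv; rewrite -scaleN1r; apply: subspaceZ. Qed.

Lemma subspaceB v w : X v -> X w -> X (v - w).
Proof. by move=> Xv Xw; apply: subspaceD => //; apply: subspaceN. Qed.

Lemma subspace_sum I (r : seq I) (P : pred I) (F : I -> V) :
  (forall i, P i -> X (F i)) -> X (\sum_(i <- r | P i) F i).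
Proof.
by move=> XF; elim/big_rec: _ => [|i v Pi Xv]; [exact: subspace0|
  apply: subspaceD => //; exact: XF].
Qed.

End SubspaceTheory.

Lemma subspace_in_span (V : lmodType K) (X : set V) : subspace (in_span X).
Proof.
split=> [|c v w Xv Xw]; first exact: in_span0.
by apply: in_spanD => //; exact: in_spanZ.
Qed.

Lemma in_span_min (V : lmodType K) (X Y : set V) :
  subspace Y -> X `<=` Y -> forall v, in_span X v -> Y v.
Proof.
move=> sY XY v; elim=> {v} [v /XY//||v w _ Yv _ Yw|c v _ Yv].
- exact: subspace0.
- exact: subspaceD.
- exact: subspaceZ.
Qed.

Lemma subspaceT (V : lmodType K) : subspace [set: V].
Proof. by []. Qed.

Lemma subspace_zero (V : lmodType K) : subspace [set 0 : V].
Proof. by split=> // c v w -> ->; rewrite scaler0 addr0. Qed.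

Definition lincomb (V : lmodType K) n (b : 'I_n -> V) (c : 'rV[K]_n) : V :=
  \sum_(i < n) c ord0 i *: b i.

Lemma lincomb_is_linear (V : lmodType K) n (b : 'I_n -> V) : linear (lincomb b).
Proof.
move=> k c d; rewrite /lincomb scaler_sumr -big_split; apply: eq_bigr => i _ /=.
by rewrite !mxE scalerDl scalerA.
Qed.
HB.instance Definition _ (V : lmodType K) n (b : 'I_n -> V) :=
  GRing.isLinear.Build K 'rV[K]_n V _ (lincomb b) (lincomb_is_linear b).

Lemma subspace_lincomb (V : lmodType K) (X : set V) n (b : 'I_n -> V) c :
  subspace X -> (forall i, X (b i)) -> X (lincomb b c).
Proof. by move=> sX Xb; apply: subspace_sum => // i _; exact: subspaceZ. Qed.

Definition indep_mod (V : lmodType K) (X : set V) n (b : 'I_n -> V) :=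
  forall c, X (lincomb b c) -> c = 0.

Definition spans_mod (V : lmodType K) (Y X : set V) n (b : 'I_n -> V) :=
  forall v, Y v -> exists c, X (v - lincomb b c).

(** For subspaces X of Y, this says that Y/X has dimension n. Representing a
    quotient by the pair (Y, X) lets all the exact sequences below be expressed
    by inclusions between subspaces of one space. *)
Definition rdim (V : lmodType K) (Y X : set V) (n : nat) :=
  exists b : 'I_n -> V,
    [/\ forall i, Y (b i), spans_mod Y X b & indep_mod X b].

(** Reducing each [a i] modulo X to a combination of the [b j] gives an m x n
    matrix; a vector in its left kernel would be a relation among the [a i]
    modulo X, so its rows are free. *)
Lemma indep_le_spans (V : lmodType K) (Y X : set V) m n (a : 'I_m -> V) (b : 'I_n -> V) :
  subspace X -> (forall i, Y (a i)) -> indep_mod X a -> spans_mod Y X b ->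
  (m <= n)%N.
Proof.
move=> sX Ya indep_a span_b.
have /choice[A XA] := fun i => span_b _ (Ya i).
pose M := \matrix_(i < m) A i.
have free_M : row_free M.
  apply: inj_row_free => c cM0; apply: indep_a.
  have -> : lincomb a c = \sum_(i < m) c ord0 i *: (a i - lincomb b (A i)).
    rewrite (eq_bigr _ (fun i _ => scalerBr _ _ _)) sumrB.
    rewrite -[LHS]subr0; congr (_ - _).
    rewrite -[LHS](linear0 (lincomb b)) -cM0 mulmx_sum_row linear_sum /=.
    by apply: eq_bigr => i _; rewrite linearZ /= rowK.
  by apply: subspace_sum => // i _; apply: subspaceZ.
by rewrite -(eqP free_M) rank_leq_col.
Qed.

Lemma rdim_uniq (V : lmodType K) (Y X : set V) m n :
  subspace X -> rdim Y X m -> rdim Y X n -> m = n.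
Proof.
move=> sX [a [Ya sa ia]] [b [Yb sb ib]]; apply/eqP; rewrite eqn_leq.
by rewrite (indep_le_spans sX Ya ia sb) (indep_le_spans sX Yb ib sa).
Qed.

Definition fdim (V : lmodType K) (Y X : set V) := exists n, rdim Y X n.
Definition rd (V : lmodType K) (Y X : set V) : nat := xget 0%N (rdim Y X).

Lemma fdimP (V : lmodType K) (Y X : set V) : fdim Y X -> rdim Y X (rd Y X).
Proof. by move=> [n Yn]; rewrite /rd; case: xgetP => [m ->//|/(_ n)]. Qed.

Lemma rdE (V : lmodType K) (Y X : set V) n : subspace X -> rdim Y X n -> rd Y X = n.
Proof. by move=> sX Yn; apply: (rdim_uniq sX _ Yn); apply: fdimP; exists n. Qed.

(** In a relation modulo X that involves [v], the coefficient of [v] must vanish,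
    for otherwise dividing by it would express [v] through [b]. *)
Lemma indep_extend (V : lmodType K) (X : set V) n (b : 'I_n -> V) v :
  subspace X -> indep_mod X b -> ~ (exists c, X (v - lincomb b c)) ->
  indep_mod X (fun i => if unlift ord0 i is Some j then b j else v).
Proof.
move=> sX ib nv c; rewrite /lincomb big_ord_recl unlift_none.
under eq_bigr do rewrite liftK.
set c0 := c ord0 ord0; pose c' : 'rV[K]_n := \row_(j < n) c ord0 (fintype.lift ord0 j).
have -> : \sum_(i < n) c ord0 (fintype.lift ord0 i) *: b i = lincomb b c'.
  by apply: eq_bigr => i _; rewrite mxE.
move=> Xc; have c00 : c0 = 0.
  apply/eqP/negP => /negP c00; apply: nv; exists (- (c0^-1 *: c')).
  rewrite linearN opprK linearZ/= -[v in X (v + _)]scale1r -(mulVf c00) -scalerA.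
  by rewrite -scalerDr; apply: subspaceZ.
move: Xc; rewrite c00 scale0r add0r => /ib c'0.
apply/rowP => i; rewrite mxE; case: (unliftP ord0 i) => [j|] ->//.
by move/rowP: c'0 => /(_ j); rewrite !mxE.
Qed.

(** An independent family of maximal length spans, by [indep_extend]; so
    finite-dimensionality passes to subspaces and to quotients without any
    choice of complements. *)
Lemma fdim_bounded (V : lmodType K) (Y X : set V) N : subspace X ->
  (forall n (b : 'I_n -> V), (forall i, Y (b i)) -> indep_mod X b -> (n <= N)%N) ->
  fdim Y X.
Proof.
move=> sX bnd.
pose P n := `[< exists b : 'I_n -> V, (forall i, Y (b i)) /\ indep_mod X b >].
have P0 : exists n, P n.
  by exists 0%N; apply/asboolP; exists (fun=> 0); split=> [[]//|c _]; exact: thinmx0.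
have PN n : P n -> (n <= N)%N by move=> /asboolP[b [Yb ib]]; exact: bnd Yb ib.
case: (ex_maxnP P0 PN) => n /asboolP[b [Yb ib]] nmax; exists n, b; split=> // v Yv.
apply: contrapT => nv; suff /nmax : P n.+1 by rewrite ltnn.
apply/asboolP; exists (fun i => if unlift ord0 i is Some j then b j else v).
by split=> [i|]; [case: unlift|exact: indep_extend].
Qed.

Lemma fdim_sub (V : lmodType K) (W Y X : set V) :
  subspace X -> Y `<=` W -> fdim W X -> fdim Y X.
Proof.
move=> sX YW [N [b [Wb sb ib]]]; apply: (@fdim_bounded _ _ _ N) => // n a Ya ia.
by apply: (indep_le_spans sX _ ia sb) => i; apply: YW.
Qed.

Lemma fdim_quot (V : lmodType K) (W Y X : set V) :
  subspace X -> subspace Y -> X `<=` Y -> fdim W X -> fdim W Y.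
Proof.
move=> sX sY XY [N [b [Wb sb ib]]]; apply: (@fdim_bounded _ _ _ N) => // n a Wa ia.
by apply: (indep_le_spans sX Wa _ sb) => c /XY; exact: ia.
Qed.

Lemma rdim_tower (V : lmodType K) (W Y X : set V) m n :
  subspace X -> X `<=` Y -> subspace Y -> Y `<=` W ->
  rdim Y X m -> rdim W Y n -> rdim W X (m + n).
Proof.
move=> sX XY sY YW [a [Ya sa ia]] [b [Wb sb ib]].
pose g (i : 'I_(m + n)) := match fintype.split i with inl j => a j | inr j => b j end.
have gE c : lincomb g c = lincomb a (lsubmx c) + lincomb b (rsubmx c).
  rewrite /lincomb big_split_ord /=; congr (_ + _); apply: eq_bigr => i _.
    by rewrite /g mxE (unsplitK (inl i)).
  by rewrite /g mxE (unsplitK (inr i)).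
exists g; split.
- by move=> i; rewrite /g; case: fintype.split => j //; exact: YW.
- move=> v /sb[d Yd]; have [c Xc] := sa _ Yd; exists (row_mx c d).
  by rewrite gE row_mxKl row_mxKr opprD addrA addrAC.
- move=> c; rewrite gE => Xc.
  have r0 : rsubmx c = 0.
    apply: ib; rewrite -[lincomb b _](addKr (lincomb a (lsubmx c))) addrC.
    by apply: subspaceB => //; [exact: XY|exact: subspace_lincomb].
  have l0 : lsubmx c = 0 by apply: ia; move: Xc; rewrite r0 linear0 addr0.
  by rewrite -[c]hsubmxK r0 l0 row_mx0.
Qed.

Lemma fdim_tower (V : lmodType K) (W Y X : set V) :
  subspace X -> X `<=` Y -> subspace Y -> Y `<=` W ->
  fdim Y X -> fdim W Y -> fdim W X.
Proof.
by move=> ? ? ? ? [m ?] [n ?]; exists (m + n)%N; apply: (@rdim_tower _ W Y X).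
Qed.

Lemma rd_tower (V : lmodType K) (W Y X : set V) :
  subspace X -> X `<=` Y -> subspace Y -> Y `<=` W ->
  fdim Y X -> fdim W Y -> rd W X = (rd Y X + rd W Y)%N.
Proof.
move=> sX XY sY YW fYX fWY; apply: rdE => //.
by apply: (rdim_tower sX XY sY YW); apply: fdimP.
Qed.

(** It is the map from Y/X to Y'/X' induced by [f] that is an isomorphism, not [f]
    itself. With [f] the identity this covers
    the second isomorphism theorem, with [f] a differential it identifies
    coboundaries. *)
Definition quot_iso (V W : lmodType K) (f : {linear V -> W})
    (Y X : set V) (Y' X' : set W) :=
  [/\ forall v, Y v -> Y' (f v),
      forall v, X v -> X' (f v),
      forall v, Y v -> X' (f v) -> X v &
      forall w, Y' w -> exists2 v, Y v & X' (w - f v)].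

Lemma lincomb_lin (V W : lmodType K) (f : {linear V -> W}) n (b : 'I_n -> V) c :
  f (lincomb b c) = lincomb (f \o b) c.
Proof. by rewrite linear_sum; apply: eq_bigr => i _; rewrite linearZ. Qed.

Lemma rdim_iso (V W : lmodType K) (f : {linear V -> W}) Y X Y' X' n :
  subspace X' -> subspace Y -> subspace Y' ->
  quot_iso f Y X Y' X' -> rdim Y X n <-> rdim Y' X' n.
Proof.
move=> sX' sY sY' [fY fX injf surjf]; split=> [[b [Yb sb ib]]|[b' [Yb' sb' ib']]].
- exists (f \o b); split=> [i|w Yw|c]; first exact: fY.
    have [v Yv X'v] := surjf w Yw; have [c Xc] := sb v Yv; exists c.
    rewrite -lincomb_lin -(subrK (f v) w) -addrA -linearB.
    by apply: subspaceD => //; apply: fX.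
  by rewrite -lincomb_lin => X'c; apply: ib; apply: injf => //; exact: subspace_lincomb.
- have /choice[b Hb] i : exists v, Y v /\ X' (b' i - f v).
    by have [v] := surjf _ (Yb' i); exists v.
  have E c : X' (lincomb b' c - f (lincomb b c)).
    rewrite lincomb_lin /lincomb -sumrB; apply: subspace_sum => // i _.
    by rewrite -scalerBr; apply: subspaceZ => //; exact: (Hb i).2.
  have Yb i : Y (b i) := (Hb i).1.
  exists b; split=> // [v Yv|c Xc].
    have [c X'c] := sb' _ (fY _ Yv); exists c; apply: injf.
      by apply: subspaceB => //; exact: subspace_lincomb.
    by rewrite linearB /= -(subrK (lincomb b' c) (f v)) -addrA; apply: subspaceD.
  apply: ib'; rewrite -(subrK (f (lincomb b c)) (lincomb b' c)).
  by apply: subspaceD => //; exact: fX.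
Qed.

Lemma rd_iso (V W : lmodType K) (f : {linear V -> W}) Y X Y' X' :
  subspace X' -> subspace Y -> subspace Y' ->
  quot_iso f Y X Y' X' -> rd Y X = rd Y' X'.
Proof.
move=> sX' sY sY' iso; rewrite /rd; congr xget.
by apply/seteqP; split=> n /(rdim_iso n sX' sY sY' iso).
Qed.

Lemma fdim_iso (V W : lmodType K) (f : {linear V -> W}) Y X Y' X' :
  subspace X' -> subspace Y -> subspace Y' ->
  quot_iso f Y X Y' X' -> fdim Y X <-> fdim Y' X'.
Proof.
by move=> sX' sY sY' iso; split=> -[n] /(rdim_iso n sX' sY sY' iso); exists n.
Qed.

End RelativeDimension.

(** * Euler characteristics of pairs of subcomplexes *)

Section RelativeHomology.
Variable K : fieldType.

Section Complex.
Variables (C : nat -> lmodType K) (d : forall p, {linear C p.+1 -> C p}).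
Implicit Types F : forall p, set (C p).

Definition is_complex := forall p v, d p (d p.+1 v) = 0.

Definition subcomplex F :=
  (forall p, subspace (F p)) /\ forall p v, F p.+1 v -> F p (d p v).

(** The convention C_(-1) = 0 makes the condition void in degree 0. *)
Definition bdry_in F (p : nat) : set (C p) :=
  match p with
  | 0%N => setT
  | q.+1 => [set v | F q (d q v)]
  end.
Arguments bdry_in F p : clear implicits.

(** [rcyc] and [rbnd] are the preimages in F of the cycles and of the boundaries
    of F/F', so that H_p(F/F') is the subquotient [rcyc F F' p / rbnd F F' p]. *)
Definition rcyc F F' p : set (C p) := F p `&` bdry_in F' p.
Arguments rcyc F F' p : clear implicits.

Definition rbnd F F' p : set (C p) :=
  [set v | exists2 w, F p.+1 w & F' p (v - d p w)].
Arguments rbnd F F' p : clear implicits.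

(** The complex F/F' has finite-dimensional total homology, of Euler
    characteristic e. *)
Definition euler F F' (e : int) := exists N,
  [/\ forall p, fdim (rcyc F F' p) (rbnd F F' p),
      forall p, (N <= p)%N -> rd (rcyc F F' p) (rbnd F F' p) = 0%N &
      e = \sum_(p < N) (-1) ^+ p * (rd (rcyc F F' p) (rbnd F F' p))%:Z].

Lemma subspace_rcyc F F' p : subcomplex F -> subcomplex F' ->
  subspace (rcyc F F' p).
Proof.
move=> [sF _] [sF' _]; rewrite /rcyc; split=> [|c v w [Fv dv] [Fw dw]].
  by split; [exact: (subspace0 (sF p))|case: p => //= p; rewrite linear0; exact: subspace0].
split; first exact: (sF p).2.
by case: p v w Fv dv Fw dw => //= p v w Fv dv Fw dw; rewrite linearP; exact: (sF' p).2.
Qed.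

Lemma subspace_rbnd F F' p : subcomplex F -> subcomplex F' ->
  subspace (rbnd F F' p).
Proof.
move=> [sF _] [sF' _]; split=> [|c v w [v' Fv' v'E] [w' Fw' w'E]].
  by exists 0; [exact: subspace0|rewrite linear0 subr0; exact: subspace0].
exists (c *: v' + w'); first exact: (sF p.+1).2.
by rewrite linearP opprD addrACA -scalerBr; exact: (sF' p).2.
Qed.

Lemma euler_ge F F' e N0 : euler F F' e -> exists2 N, (N0 <= N)%N &
  [/\ forall p, fdim (rcyc F F' p) (rbnd F F' p),
      forall p, (N <= p)%N -> rd (rcyc F F' p) (rbnd F F' p) = 0%N &
      e = \sum_(p < N) (-1) ^+ p * (rd (rcyc F F' p) (rbnd F F' p))%:Z].
Proof.
move=> [N [fF vF ->]]; exists (N + N0)%N; first exact: leq_addl.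
split=> // [p Np|]; first by apply: vF; apply: leq_trans Np; exact: leq_addr.
rewrite big_split_ord /= [X in _ = _ + X]big1 ?addr0// => i _.
by rewrite vF ?mulr0// leq_addr.
Qed.

Lemma euler_uniq F F' e e' : euler F F' e -> euler F F' e' -> e = e'.
Proof.
move=> eF [N' eF']; have [N NN' [_ _ ->]] := euler_ge N' eF.
case: eF' => _ vF' ->; rewrite -(subnKC NN') big_split_ord /=.
by rewrite [X in _ + X]big1 ?addr0// => i _; rewrite vF' ?mulr0// leq_addr.
Qed.

(** The long exact sequence of the triple F'' <= F' <= F, split into short exact
    sequences. With al, be and ga the ranks of H(F'/F'') -> H(F/F''),
    of H(F/F'') -> H(F/F') and of the connecting map H(F/F') -> H(F'/F''), the three
    Betti numbers are a_p = al_p + ga_(p+1), b_p = al_p + be_p and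
    c_p = be_p + ga_p. Each rank is the dimension of a subquotient in two ways, and
    [isoA], [isoB] and [isoC] compare them. *)
Section Triple.
Local Unset Implicit Arguments.
Variables F'' F' F : forall p, set (C p).
Hypotheses (dd : is_complex) (cF'' : subcomplex F'') (cF' : subcomplex F')
  (cF : subcomplex F) (F''F' : forall p, F'' p `<=` F' p)
  (F'F : forall p, F' p `<=` F p).

Let Z1 := rcyc F' F''. Let B1 := rbnd F' F''.
Let Z2 := rcyc F F''.  Let B2 := rbnd F F''.
Let Z3 := rcyc F F'.   Let B3 := rbnd F F'.
(* FB/B1 is the kernel of H(F'/F'') -> H(F/F''), BZ/B2 its image, and FZ/B3 the
   image of H(F/F'') -> H(F/F'). *)
Let FB p := B2 p `&` F' p.
Let BZ p : set (C p) := [set v | exists2 w, Z1 p w & B2 p (v - w)].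
Let FZ p : set (C p) := [set v | exists2 w, Z2 p w & F' p (v - w)].

Let sZ1 p : subspace (Z1 p). Proof. exact: subspace_rcyc. Qed.
Let sZ2 p : subspace (Z2 p). Proof. exact: subspace_rcyc. Qed.
Let sZ3 p : subspace (Z3 p). Proof. exact: subspace_rcyc. Qed.
Let sB1 p : subspace (B1 p). Proof. exact: subspace_rbnd. Qed.
Let sB2 p : subspace (B2 p). Proof. exact: subspace_rbnd. Qed.
Let sB3 p : subspace (B3 p). Proof. exact: subspace_rbnd. Qed.
Let sF p : subspace (F p). Proof. exact: cF.1. Qed.
Let sF' p : subspace (F' p). Proof. exact: cF'.1. Qed.
Let sF'' p : subspace (F'' p). Proof. exact: cF''.1. Qed.

Local Hint Resolve sF sF' sF'' sZ1 sZ2 sZ3 sB1 sB2 sB3 : core.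

Let sFB p : subspace (FB p).
Proof.
split=> [|c v w [? ?] [? ?]]; split; first [exact: subspace0|exact: (sB2 p).2|exact: (sF' p).2].
Qed.

Let sSum (X Y : forall p, set (C p)) p : subspace (X p) -> subspace (Y p) ->
  subspace [set v | exists2 w, X p w & Y p (v - w)].
Proof.
move=> sX sY; split=> [|c v w [v' Xv' Yv'] [w' Xw' Yw']].
  by exists 0; [exact: subspace0|rewrite subr0; exact: subspace0].
exists (c *: v' + w'); first exact: sX.2.
by rewrite opprD addrACA -scalerBr; exact: sY.2.
Qed.

Let sBZ p : subspace (BZ p). Proof. exact: sSum. Qed.
Let sFZ p : subspace (FZ p). Proof. exact: sSum. Qed.
Local Hint Resolve sFB sBZ sFZ : core.

Let bdry_inS X Y p : (forall q, X q `<=` Y q) -> bdry_in X p `<=` bdry_in Y p.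
Proof. by case: p => //= p XY v; exact: XY. Qed.

Let B2Z2 p : B2 p `<=` Z2 p.
Proof.
move=> v [w Fw F''vw]; split.
  rewrite -(subrK (d p w) v); apply: subspaceD => //; last exact: cF.2.
  by apply: F'F; exact: F''F'.
case: p v w Fw F''vw => //= p v w Fw /cF''.2.
by rewrite linearB /= dd subr0.
Qed.

Let FBZ1 p : FB p `<=` Z1 p.
Proof. by move=> v [/B2Z2[_ ?] ?]; split. Qed.

Let B1FB p : B1 p `<=` FB p.
Proof.
move=> v [w Fw F''vw]; split; first by exists w => //; exact: F'F.
rewrite -(subrK (d p w) v); apply: subspaceD => //; last exact: cF'.2.
exact: F''F'.
Qed.

Let Z1Z2 p : Z1 p `<=` Z2 p.
Proof. by move=> v [? ?]; split => //; exact: F'F. Qed.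

Let Z2Z3 p : Z2 p `<=` Z3 p.
Proof. by move=> v [? ?]; split => //; exact: (bdry_inS F'' F'). Qed.

Let isoA p : quot_iso (idfun : {linear C p -> C p}) (Z1 p) (FB p) (BZ p) (B2 p).
Proof.
split=> /= [v Zv|v []//|v [Fv _] Bv //|w [v Zv Bv]]; last by exists v.
by exists v => //; rewrite subrr; exact: subspace0.
Qed.

Let isoB p : quot_iso (idfun : {linear C p -> C p}) (Z2 p) (BZ p) (FZ p) (B3 p).
Proof.
split=> /= [v Zv|v [w [Fw _] [u Fu F''u]]|v Zv [u Fu F'u]|w [v Zv F'v]].
- by exists v => //; rewrite subrr; exact: subspace0.
- exists u => //; rewrite -(subrK w v) addrAC.
  by apply: subspaceD => //; exact: F''F'.
- exists (v - d p u).
    split=> //; have [_] : Z2 p (v - d p u).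
      apply: subspaceB => //; apply: B2Z2; exists u => //.
      by rewrite subrr; exact: subspace0.
    by [].
  rewrite opprB addrC subrK; exists u => //; rewrite subrr; exact: subspace0.
- exists v => //; exists 0; first exact: subspace0.
  by rewrite linear0 subr0.
Qed.

Let isoC p : quot_iso (d p) (Z3 p.+1) (FZ p.+1) (FB p) (B1 p).
Proof.
split=> /= [v [Fv F'dv]|v [w [Fw F''dw] F'vw]|v [Fv _] [w F'w F''dw]|u [[w Fw F''uw] F'u]].
- split=> //; exists v => //; rewrite subrr; exact: subspace0.
- exists (v - w) => //; rewrite linearB opprB addrC subrK; exact: F''dw.
- exists (v - w); last by rewrite opprB addrC subrK.
  split; last by rewrite /= linearB.
  by apply: subspaceB => //; exact: F'F.
- exists w.
    split => //=; rewrite -(subKr u (d p w)).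
    by apply: subspaceB => //; exact: F''F'.
  by exists 0; [exact: subspace0|rewrite linear0 subr0].
Qed.

Let FZ0 : FZ 0%N = Z3 0%N.
Proof.
apply/seteqP; split=> v [].
  move=> w [Fw _] F'w; split=> //; rewrite -(subrK w v).
  by apply: subspaceD => //; exact: F'F.
move=> Fv _; exists v; first by split.
by rewrite subrr; exact: subspace0.
Qed.

Let B2BZ p : B2 p `<=` BZ p.
Proof. by move=> v Bv; exists 0; rewrite ?subr0//; exact: subspace0. Qed.
Let BZZ2 p : BZ p `<=` Z2 p.
Proof.
move=> v [w /Z1Z2 Zw /B2Z2 Zv]; rewrite -(subrK w v); exact: subspaceD.
Qed.
Let F'Z3 p : F' p `<=` Z3 p.
Proof.
move=> v F'v; split; first exact: F'F.
by case: p v F'v => //= p v; exact: cF'.2.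
Qed.
Let FZZ3 p : FZ p `<=` Z3 p.
Proof.
move=> v [w /Z2Z3 Zw /F'Z3 Fv]; rewrite -(subrK w v); exact: subspaceD.
Qed.
Let B3FZ p : B3 p `<=` FZ p.
Proof.
move=> v [w Fw F'v]; exists (d p w) => //; apply: B2Z2; exists w => //.
by rewrite subrr; exact: subspace0.
Qed.

Let a p := rd (Z1 p) (B1 p).
Let b p := rd (Z2 p) (B2 p).
Let c p := rd (Z3 p) (B3 p).
Let al p := rd (Z1 p) (FB p).
Let be p := rd (Z2 p) (BZ p).
Let ga p := rd (Z3 p) (FZ p).

Let rdaP p : fdim (Z1 p) (FB p) -> fdim (FB p) (B1 p) -> a p = (al p + ga p.+1)%N.
Proof.
move=> f1 f2; rewrite /a (@rd_tower _ _ _ (FB p) (B1 p))// addnC; congr addn.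
exact/esym/(@rd_iso _ _ _ (d p)).
Qed.

Let rdbP p : fdim (BZ p) (B2 p) -> fdim (Z2 p) (BZ p) -> b p = (al p + be p)%N.
Proof.
move=> f1 f2; rewrite /b (@rd_tower _ _ _ (BZ p) (B2 p))//; congr addn.
exact/esym/(@rd_iso _ _ _ idfun).
Qed.

Let rdcP p : fdim (FZ p) (B3 p) -> fdim (Z3 p) (FZ p) -> c p = (be p + ga p)%N.
Proof.
move=> f1 f2; rewrite /c (@rd_tower _ _ _ (FZ p) (B3 p))//; congr addn.
exact/esym/(@rd_iso _ _ _ idfun).
Qed.

(* The connecting map vanishes in degree 0, which starts the telescoping sum. *)
Let ga0 : ga 0 = 0%N.
Proof.
rewrite /ga FZ0; apply: rdE => //; exists (fun=> 0); split=> [[]//|v Zv|x _].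
  by exists 0; rewrite linear0 subr0.
exact: thinmx0.
Qed.

Let alt_sum N : (forall p, a p = (al p + ga p.+1)%N) ->
  (forall p, b p = (al p + be p)%N) -> (forall p, c p = (be p + ga p)%N) ->
  \sum_(p < N) (-1) ^+ p * (a p)%:Z + \sum_(p < N) (-1) ^+ p * (c p)%:Z
  = \sum_(p < N) (-1) ^+ p * (b p)%:Z - (-1) ^+ N * (ga N)%:Z.
Proof.
move=> aE bE cE; elim: N => [|N IH]; first by rewrite !big_ord0 ga0 mulr0 subr0.
rewrite !big_ord_recr /= addrACA IH aE bE cE !PoszD exprS; ring.
Qed.

(** If a and c are finite, then so are al, as a quotient of a, and be, as a subspace
    of c. *)
Lemma euler_ext e1 e3 : euler F' F'' e1 -> euler F F' e3 -> euler F F'' (e1 + e3).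
Proof.
move=> E1 E3; have [N1 [fa va ->]] := E1.
have [N NN1 [fc vc' ->]] := euler_ge N1 E3.
have fal p : fdim (Z1 p) (FB p) by apply: fdim_quot (fa p).
have fga' p : fdim (FB p) (B1 p) by apply: fdim_sub (fa p).
have fbe' p : fdim (FZ p) (B3 p) by apply: fdim_sub (fc p).
have fga p : fdim (Z3 p) (FZ p) by apply: fdim_quot (fc p).
have fbe p : fdim (Z2 p) (BZ p) by apply/(fdim_iso _ _ _ (isoB p)).
have fal' p : fdim (BZ p) (B2 p) by apply/(fdim_iso _ _ _ (isoA p)).
have aE p := rdaP p (fal p) (fga' p).
have bE p := rdbP p (fal' p) (fbe p).
have cE p := rdcP p (fbe' p) (fga p).
have va' p : (N <= p)%N -> a p = 0%N by move=> Np; apply: va; exact: leq_trans Np.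
exists N; split=> [p|p Np|].
- exact: (fdim_tower _ (@B2BZ p)).
- rewrite -/(b p) bE; move: (va' p Np) (vc' p Np); rewrite -/(c p) aE cE.
  by case: (al p) => //; case: (be p).
- have := alt_sum N aE bE cE.
  have -> : ga N = 0%N by move: (vc' N (leqnn N)); rewrite -/(c N) cE; lia.
  rewrite mulr0 subr0 => <-; congr (_ + _).
  rewrite -(subnKC NN1) big_split_ord /=.
  by rewrite [X in _ = _ + X]big1 ?addr0// => i _; rewrite /a va ?mulr0// leq_addr.
Qed.

(** Here ga_(p+1) is finite because it is a summand of a_p; the shift by one degree
    is why the bound beyond which homology vanishes grows by one. *)
Lemma euler_quot e1 e2 : euler F' F'' e1 -> euler F F'' e2 -> euler F F' (e2 - e1).
Proof.
move=> E1 [N2 [fb vb e2E]].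
have [N N2N [fa va ->]] := euler_ge N2 E1.
have fal p : fdim (Z1 p) (FB p) by apply: fdim_quot (fa p).
have fga' p : fdim (FB p) (B1 p) by apply: fdim_sub (fa p).
have fbe p : fdim (Z2 p) (BZ p) by apply: fdim_quot (fb p).
have fal' p : fdim (BZ p) (B2 p) by apply: fdim_sub (fb p).
have fbe' p : fdim (FZ p) (B3 p) by apply/(fdim_iso _ _ _ (isoB p)).
have fga p : fdim (Z3 p) (FZ p).
  case: p => [|p]; last by apply/(fdim_iso _ _ _ (isoC p)).
  rewrite FZ0; exists 0%N, (fun=> 0); split=> [[]//|v Zv|x _].
    by exists 0; rewrite linear0 subr0.
  exact: thinmx0.
have aE p := rdaP p (fal p) (fga' p).
have bE p := rdbP p (fal' p) (fbe p).
have cE p := rdcP p (fbe' p) (fga p).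
have gaN p : (N < p)%N -> ga p = 0%N.
  case: p => // p; rewrite ltnS => Np; move: (va p Np); rewrite -/(a p) aE; lia.
exists N.+1; split=> [p|p Np|].
- exact: (fdim_tower _ (@B3FZ p)).
- have := vb p (leq_trans N2N (ltnW Np)).
  by rewrite -/(c p) -/(b p) cE bE gaN// addn0; case: (be p) => // n; lia.
- have := alt_sum N.+1 aE bE cE.
  rewrite gaN// mulr0 subr0 => cS.
  rewrite -[RHS](addKr (\sum_(p < N.+1) (-1) ^+ p * (a p)%:Z)) cS [RHS]addrC.
  congr (_ - _).
    rewrite e2E -(subnKC (leqW N2N)) big_split_ord /=.
    by rewrite [X in _ = _ + X]big1 ?addr0// => i _; rewrite /b vb ?mulr0// leq_addr.
  by rewrite big_ord_recr /= [X in _ = _ + X](_ : _ = 0) ?addr0// /a va ?mulr0.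
Qed.

End Triple.
Local Set Implicit Arguments.
End Complex.

Arguments bdry_in {C} d F p.
Arguments rcyc {C} d F F' p.
Arguments rbnd {C} d F F' p.

Section Transfer.
Variables (C D : nat -> lmodType K).
Variables (dC : forall p, {linear C p.+1 -> C p}) (dD : forall p, {linear D p.+1 -> D p}).
Variable f : forall p, {linear C p -> D p}.
Hypothesis fd_comm : forall p v, f p (dC p v) = dD p (f p.+1 v).
Variables (F F' : forall p, set (C p)) (G G' : forall p, set (D p)).
Arguments F p _ : clear implicits.
Arguments F' p _ : clear implicits.
Arguments G p _ : clear implicits.
Arguments G' p _ : clear implicits.
Hypotheses (cF : subcomplex dC F) (cF' : subcomplex dC F')
  (cG : subcomplex dD G) (cG' : subcomplex dD G').
Hypothesis iso : forall p, quot_iso (f p) (F p) (F' p) (G p) (G' p).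
Hypothesis F'F : forall p, F' p `<=` F p.

(** A relative cycle of G/G' lifts to F modulo G' by surjectivity, and the lift is a
    relative cycle by injectivity one degree below. *)
Lemma rel_homology_iso p :
  quot_iso (f p) (rcyc dC F F' p) (rbnd dC F F' p) (rcyc dD G G' p) (rbnd dD G G' p).
Proof.
have [fF fF' injf surjf] := iso p; split.
- move=> v [Fv dv]; split; first exact: fF.
  case: p v dv {fF fF' injf surjf Fv} => //= p v dv.
  by rewrite -fd_comm; have [_ + _ _] := iso p; apply.
- move=> v [w Fw F'vw]; exists (f p.+1 w).
    by have [+ _ _ _] := iso p.+1; apply.
  by rewrite -fd_comm -linearB; exact: fF'.
- move=> v [Fv dv] [g Gg G'g].
  have [_ _ _ surjf1] := iso p.+1; have [w Fw G'w] := surjf1 g Gg.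
  exists w => //; apply: injf.
    by apply: subspaceB => //; [exact: cF.1|exact: cF.2].
  rewrite linearB /= fd_comm -(subrK (dD p g) (f p v)) -addrA -linearB.
  by apply: subspaceD => //; [exact: cG'.1|exact: cG'.2].
- move=> g [Gg dg]; have [w Fw G'w] := surjf g Gg; exists w; last first.
    exists 0; first exact: (subspace0 (cG.1 _)).
    by rewrite linear0 subr0.
  split=> //; case: p g w Gg dg Fw G'w {fF fF' injf surjf} => //= p g w Gg dg Fw G'w.
  have [_ _ injf _] := iso p; apply: injf; first exact: cF.2.
  rewrite fd_comm -(subKr (dD p g) (dD p (f p.+1 w))) -linearB.
  by apply: subspaceB => //; [exact: cG'.1|exact: cG'.2].
Qed.

Lemma euler_iso e : euler dC F F' e <-> euler dD G G' e.
Proof.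
have sB p : subspace (rbnd dD G G' p) by exact: subspace_rbnd.
have sC p : subspace (rcyc dC F F' p) by exact: subspace_rcyc.
have sD p : subspace (rcyc dD G G' p) by exact: subspace_rcyc.
have E p := rd_iso (sB p) (sC p) (sD p) (rel_homology_iso p).
have Ef p := fdim_iso (sB p) (sC p) (sD p) (rel_homology_iso p).
split=> -[N [fE vE ->]]; exists N; split.
- by move=> p; apply/Ef.
- by move=> p Np; rewrite -E vE.
- by apply: eq_bigr => p _; rewrite E.
- by move=> p; apply/Ef.
- by move=> p Np; rewrite E vE.
- by apply: eq_bigr => p _; rewrite E.
Qed.

End Transfer.

Lemma euler_trivial (C : nat -> lmodType K) (d : forall p, {linear C p.+1 -> C p}) F :
  subcomplex d F -> euler d F F 0.
Proof.
move=> cF; have zero p : rdim (rcyc d F F p) (rbnd d F F p) 0.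
  exists (fun=> 0); split=> [[]//|v [Fv _]|c _]; last exact: thinmx0.
  exists 0; rewrite linear0 subr0; exists 0; first exact: subspace0 (cF.1 _).
  by rewrite linear0 subr0.
exists 0%N; split=> [p|p _|]; [by exists 0%N| |by rewrite big_ord0].
by apply: rdE (zero p); exact: subspace_rbnd.
Qed.

End RelativeHomology.

Arguments bdry_in {K C} d F p.
Arguments rcyc {K C} d F F' p.
Arguments rbnd {K C} d F F' p.

(** * Homology spaces as subquotients *)

Section HomologyDimension.
Variable K : fieldType.

Lemma basis_rdim (V : lmodType K) n :
  (exists b : 'I_n -> V, is_basis b) <-> rdim [set: V] [set 0] n.
Proof.
have toF (b : 'I_n -> V) (c : 'rV[K]_n) :
    \sum_(i < n) [ffun i => c ord0 i] i *: b i = lincomb b c.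
  by apply: eq_bigr => i _; rewrite ffunE.
have toR (b : 'I_n -> V) (c : {ffun 'I_n -> K}) :
    lincomb b (\row_i c i) = \sum_(i < n) c i *: b i.
  by apply: eq_bigr => i _; rewrite mxE.
split=> [[b bb]|[b [_ sb ib]]]; exists b.
- split=> // [v _|c c0].
    by have [c [vE _]] := bb v; exists (\row_i c i); rewrite toR -vE subrr.
  have [c' [_ c'U]] := bb 0; apply/rowP => i; rewrite mxE.
  have E := c'U [ffun i => c ord0 i]; have E0 := c'U [ffun=> 0].
  have /ffunP/(_ i) : [ffun i => c ord0 i] = [ffun=> 0].
    rewrite -E ?toF//; rewrite -E0// big1// => j _; by rewrite ffunE scale0r.
  by rewrite !ffunE.
- move=> v; have [//|c vc] := sb v; exists [ffun i => c ord0 i]; split.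
    by rewrite toF; apply/eqP; rewrite -subr_eq0 vc.
  move=> c' vE; apply/ffunP => i; rewrite ffunE.
  have /rowP/(_ i) : c - \row_i c' i = 0; last by rewrite !mxE => /subr0_eq.
  by apply: ib; rewrite linearB /= toR -vE -opprB vc oppr0.
Qed.

Lemma dimE_rdim (R : realType) (V : lmodType K) n :
  rdim [set: V] [set 0] n -> dimE R V = n%:R%:E.
Proof.
move=> Vn; rewrite /dimE; case: xgetP => [_ -> [m /basis_rdim Vm <-]|].
  by rewrite (rdim_uniq _ Vm Vn)//; exact: subspace_zero.
by move=> /(_ n%:R%:E); case; exists n => //=; apply/basis_rdim.
Qed.

Variables (C : nat -> lmodType K) (d : forall p, {linear C p.+1 -> C p}).

Let sT : subcomplex d (fun p => [set: C p]).
Proof. by split=> // p; exact: subspaceT. Qed.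
Let s0 : subcomplex d (fun p => [set (0 : C p)]).
Proof. by split=> [p|p v /= ->]; [exact: subspace_zero|exact: linear0]. Qed.

(** Two passages: from the quotient of the space of cycles to a subquotient of it,
    and from there into C_p by the inclusion of the cycles. *)
Lemma homology_rdim p n : is_complex d ->
  rdim [set: homology d p] [set 0] n <->
  rdim (rcyc d (fun p => [set: C p]) (fun p => [set 0]) p)
       (rbnd d (fun p => [set: C p]) (fun p => [set 0]) p) n.
Proof.
move=> dd.
set X := [set z : cycles d p | exists c : C p.+1, val z = d p c].
have i1 : quot_iso (qpi X : {linear cycles d p -> homology d p})
    setT (in_span X) setT [set 0].
  split=> //= [z Xz|z _|w _].
  - by rewrite -(linear0 (qpi X)); apply/qpi_eq; rewrite subr0.
  - by rewrite -(linear0 (qpi X)) => /qpi_eq; rewrite subr0.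
  - by exists (repr w) => //; rewrite qpiK subrr.
have i2 : quot_iso (val : {linear cycles d p -> C p}) setT (in_span X)
    (rcyc d (fun p => [set: C p]) (fun p => [set 0]) p)
    (rbnd d (fun p => [set: C p]) (fun p => [set 0]) p).
  split=> /= [z _|z|z _ [c _ zc]|v [_ dv]].
  - split=> //; case: z => z /=; case: p {X i1} z => //= p z.
    by rewrite unfold_in => /eqP.
  - apply: (in_span_min (Y := [set z : cycles d p |
      rbnd d (fun p => [set: C p]) (fun p => [set 0]) p (val z)]));
      last by move=> {}z [c zc]; exists c; rewrite //= zc subrr.
    have [r0 rP] := subspace_rbnd p sT s0.
    pose vl := (val : {linear cycles d p -> C p}).
    split=> [|c u w /= /(rP c) uB /uB].
      by have := linear0 vl; rewrite /vl /= => ->.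
    by have := linearP vl c u w; rewrite /vl /= => ->.
  - by apply: in_span_gen; exists c; apply/eqP; rewrite -subr_eq0 zc.
  - have vc : v \in @is_cycle _ _ d p.
      by case: p v dv {X i1} => //= p v dv; rewrite unfold_in /= dv.
    exists (exist _ v vc) => //; rewrite subrr; exact: subspace0 (subspace_rbnd p sT s0).
rewrite -(rdim_iso n (subspace_zero _) (subspaceT _) (subspaceT _) i1).
apply: (rdim_iso n _ (subspaceT _) _ i2); first exact: subspace_rbnd.
exact: subspace_rcyc.
Qed.

End HomologyDimension.

(** * Tensoring with the group algebra *)

Section FreeModule.
Variable K : fieldType.

Lemma freegU_scale (S : choiceType) c (s : S) :
  << c *g s >> = c *: << s >> :> {freeg S / K}.
Proof. by apply/eqP/freeg_eqP => t; rewrite coeffZ !coeffU mul1r. Qed.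

Lemma freeg_span_ind (S : choiceType) (X : set {freeg S / K}) :
  subspace X -> (forall s, X << s >>) -> forall v, X v.
Proof.
move=> sX XU v; rewrite -(freeg_sumE v); apply: (subspace_sum sX) => s _.
by rewrite freegU_scale; exact: subspaceZ.
Qed.

End FreeModule.

Section SplittingTensor.
Variables (K : fieldType) (G : category) (x : G).

Definition aut1 : aut x := exist _ (idm x) (introT (asboolP _) (is_iso_id x)).

Lemma aut_comp1 (a : aut x) : aut_comp a aut1 = a.
Proof. by apply/val_inj; rewrite /= hcompf1. Qed.

Variable M : cmod K G.

Let rel := tensor_rel (fun a : aut x => S_act M a) (fun a : aut x => vN_act K a).
Local Notation "m ⊗ n" := (<< (m, n) >> : {freeg (S_ob x M * vN_algebra K x)%type / K})
  (at level 40).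

Lemma S_actE (a : aut x) (v : M x) :
  S_act M a (qpi (@noniso_image K G x M) v) = qpi _ (cmod_map M (sval a) v).
Proof. exact: qlinE. Qed.

Lemma S_act_comp (a b : aut x) (m : S_ob x M) :
  S_act M b (S_act M a m) = S_act M (aut_comp a b) m.
Proof.
by rewrite -[m]qpiK; move: (repr m) => v; rewrite [S_act M a _]S_actE !S_actE -cmod_map_comp.
Qed.

Lemma S_act1 (m : S_ob x M) : S_act M aut1 m = m.
Proof. by rewrite -[m]qpiK; move: (repr m) => v; rewrite S_actE cmod_map_id. Qed.

(** The quotient map from M(x) to S_x M followed by the isomorphism
    [m |-> m (x) 1] from S_x M to its tensor product with the group algebra: this
    presents the latter as M(x) modulo the images of non-isomorphisms, naturally
    in M. *)
Definition S_tensor_pi (v : M x) : S_tensor x M :=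
  qpi rel (qpi (@noniso_image K G x M) v ⊗ << aut1 >>).

Let piD m m' n : qpi rel ((m + m') ⊗ n) = qpi rel (m ⊗ n) + qpi rel (m' ⊗ n).
Proof.
rewrite -qpiD; apply/qpi_eq; rewrite opprD addrA; apply: in_span_gen.
exact: tensor_relDl.
Qed.

Let piZ c m n : qpi rel ((c *: m) ⊗ n) = c *: qpi rel (m ⊗ n).
Proof.
rewrite -linearZ; apply/qpi_eq; apply: in_span_gen; exact: tensor_relZl.
Qed.

Lemma S_tensor_pi_linear : linear S_tensor_pi.
Proof. by move=> c v w; rewrite /S_tensor_pi linearP piD piZ. Qed.
HB.instance Definition _ := GRing.isLinear.Build K (M x) (S_tensor x M) _
  S_tensor_pi S_tensor_pi_linear.

Let pi_add m n n' : qpi rel (m ⊗ (n + n')) = qpi rel (m ⊗ n) + qpi rel (m ⊗ n').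
Proof.
rewrite -qpiD; apply/qpi_eq; rewrite opprD addrA; apply: in_span_gen.
exact: tensor_relDr.
Qed.

Let pi_scale c m n : qpi rel (m ⊗ (c *: n)) = c *: qpi rel (m ⊗ n).
Proof.
rewrite -linearZ; apply/qpi_eq; apply: in_span_gen; exact: tensor_relZr.
Qed.

Lemma S_tensor_pi_surj (t : S_tensor x M) : exists v, S_tensor_pi v = t.
Proof.
pose Im : set (S_tensor x M) := [set t | exists v, S_tensor_pi v = t].
have sIm : subspace Im.
  split=> [|c _ _ [v <-] [w <-]]; first by exists 0; rewrite linear0.
  by exists (c *: v + w); rewrite linearP.
rewrite -[t]qpiK; move: (repr t).
have sIm' : subspace [set f | Im (qpi rel f)].
  split=> [|c v w ? ?] /=; first by rewrite linear0; exact: subspace0.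
  by rewrite linearP; exact: sIm.2.
apply: (freeg_span_ind sIm') => -[m n] /=; move: n.
have sIm'' : subspace [set n | Im (qpi rel (m ⊗ n))].
  split=> [|c v w ? ?] /=.
    by rewrite -[X in _ ⊗ X](scale0r 0) pi_scale scale0r; exact: subspace0.
  by rewrite pi_add pi_scale; exact: sIm.2.
apply: (freeg_span_ind sIm'') => a /=.
exists (repr (S_act M a m)); rewrite /S_tensor_pi qpiK.
have -> : << a >> = vN_act K a << aut1 >> by rewrite /vN_act freeg_mapU aut_comp1.
by apply/qpi_eq; apply: in_span_gen; exact: tensor_rel_act.
Qed.

(* Letting the group algebra act on S_x M gives a left inverse of [m |-> m (x) 1];
   it is defined on the free space and kills the relations of the tensor product. *)
Let act_freeg (m : S_ob x M) : {linear vN_algebra K x -> S_ob x M} :=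
  fglift (fun a : aut x => S_act M a m).

Let act_freegU m a : act_freeg m << a >> = S_act M a m.
Proof. by rewrite /act_freeg /= liftU scale1r. Qed.

Let act_freegD m m' n : act_freeg (m + m') n = act_freeg m n + act_freeg m' n.
Proof.
apply: (@freeg_linear_ext K _ _ (act_freeg (m + m'))
  (act_freeg m \+ act_freeg m')) => a.
by rewrite act_freegU linearD -!act_freegU.
Qed.

Let act_freegZ c m n : act_freeg (c *: m) n = c *: act_freeg m n.
Proof.
apply: (@freeg_linear_ext K _ _ (act_freeg (c *: m)) (c \*: act_freeg m)) => a.
by rewrite act_freegU linearZ_LR -!act_freegU.
Qed.

Let contract : {linear {freeg (S_ob x M * vN_algebra K x)%type / K} -> S_ob x M} :=
  fglift (fun mn : S_ob x M * vN_algebra K x => act_freeg mn.1 mn.2).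

Let contractU m n : contract (m ⊗ n) = act_freeg m n.
Proof. by rewrite /contract /= liftU scale1r. Qed.

Let contract_rel t : rel t -> contract t = 0.
Proof.
case=> [m m' n|m n n'|c m n|c m n|a m n]; rewrite !linearB
    ?[contract (_ *: _)]linearZ_LR !contractU.
- by rewrite act_freegD addrAC addrK subrr.
- by rewrite linearD addrAC addrK subrr.
- by rewrite act_freegZ subrr.
- by rewrite [act_freeg m _]linearZ_LR subrr.
- apply/eqP; rewrite subr_eq0; apply/eqP; move: n.
  apply: (@freeg_linear_ext K _ _ (act_freeg (S_act M a m)) (act_freeg m \o vN_act K a)).
  by move=> b; rewrite [RHS]/= /vN_act freeg_mapU !act_freegU S_act_comp.
Qed.

Lemma S_tensor_pi_ker (v : M x) :
  S_tensor_pi v = 0 <-> in_span (@noniso_image K G x M) v.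
Proof.
split=> [|vN]; last first.
  rewrite /S_tensor_pi; have -> : qpi (noniso_image (M:=M)) v = 0.
    by rewrite -[RHS](linear0 (qpi (@noniso_image K G x M))); apply/qpi_eq; rewrite subr0.
  by rewrite -(scale0r 0) piZ scale0r.
rewrite -[X in _ = X](linear0 (qpi rel)) => /qpi_eq; rewrite subr0.
move=> /(in_span_min (Y := [set t | contract t = 0]))/=.
rewrite contractU act_freegU S_act1 => C0.
suff /qpi_eq : qpi (@noniso_image K G x M) v = qpi _ 0 by rewrite subr0.
rewrite linear0; apply: C0 => [|t]; last exact: contract_rel.
split=> [|c t u t0 u0]; first exact: linear0.
have : contract (c *: t + u) = 0; last by [].
by rewrite linearP (t0 : contract t = 0) (u0 : contract u = 0) scaler0 addr0.
Qed.

End SplittingTensor.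

Lemma S_tensor_pi_nat (K : fieldType) (G : category) (x : G) (M N : cmod K G)
  (f : cmod_hom M N) (v : M x) :
  S_tensor_map x f (S_tensor_pi v) = S_tensor_pi (f x v).
Proof. by rewrite /S_tensor_pi /S_tensor_map /tensor_map qlinE freeg_mapU qlinE. Qed.

(** * The filtration of M(x) by the images of arrows out of x *)

Section ArrowFiltration.
Variables (K : fieldType) (G : category).

Definition arrow_from (x : G) : choiceType := {y : G & hom x y}.

Definition arrow_span (x : G) (L : seq (arrow_from x)) (M : cmod K G) : set (M x) :=
  in_span [set v | exists2 s, s \in L &
    exists w : M (tag s), v = cmod_map M (tagged s) w].
Arguments arrow_span : clear implicits.

Lemma arrow_span_nat x L (M N : cmod K G) (f : cmod_hom M N) v :
  arrow_span x L M v -> arrow_span x L N (f x v).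
Proof.
apply: in_span_lin => _ [s sL [w ->]]; apply: in_span_gen.
by exists s => //; exists (f _ w); rewrite cmod_hom_nat.
Qed.

Lemma noniso_span_nat x (M N : cmod K G) (f : cmod_hom M N) v :
  in_span (@noniso_image K G x M) v -> in_span (@noniso_image K G x N) (f x v).
Proof. by apply: in_span_lin => u; exact: S_map_subproof. Qed.

Lemma arrow_span_sub x L L' M v : {subset L <= L'} ->
  arrow_span x L M v -> arrow_span x L' M v.
Proof.
move=> LL'; apply: in_span_min; first exact: subspace_in_span.
by move=> u [s /LL' ? ?]; apply: in_span_gen; exists s.
Qed.

Lemma arrow_span_rcons x L t M v :
  arrow_span x (rcons L t) M v <->
  exists w : M (tag t), arrow_span x L M (v - cmod_map M (tagged t) w).
Proof.
split=> [|[w Lw]]; last first.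
  rewrite -(subrK (cmod_map M (tagged t) w) v); apply: in_spanD.
    by apply: arrow_span_sub Lw => s; rewrite mem_rcons inE orbC => ->.
  by apply: in_span_gen; exists t; [rewrite mem_rcons mem_head|exists w].
elim=> {v} [v [s]||v w _ [v' Lv] _ [w' Lw]|c v _ [v' Lv]].
- rewrite mem_rcons inE => /predU1P[->|sL] [w ->].
    by exists w; rewrite subrr; exact: in_span0.
  by exists 0; rewrite linear0 subr0; apply: in_span_gen; exists s => //; exists w.
- by exists 0; rewrite linear0 subr0; exact: in_span0.
- by exists (v' + w'); rewrite linearD opprD addrACA; exact: in_spanD.
- by exists (c *: v'); rewrite linearZ -scalerBr; exact: in_spanZ.
Qed.

Lemma arrow_span_dsum x L I (M : I -> cmod K G) v i :
  arrow_span x L (cmod_dsum M) v -> arrow_span x L (M i) ((v : dsum _) i).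
Proof.
elim=> {v} [v [s sL [w ->]]||v w _ Lv _ Lw|c v _ Lv].
- by apply: in_span_gen; exists s => //; exists ((w : dsum _) i).
- exact: in_span0.
- exact: in_spanD.
- exact: in_spanZ.
Qed.

(* The index type of a direct sum has no decidable equality, so the inclusion of a
   summand is defined by a classical case analysis and a transport. *)
Section DirectSumInjection.
Variables (I : Type) (M : I -> cmod K G) (i0 : I).

Definition dinj_fun x (v : M i0 x) (i : I) : M i x :=
  match pselect (i0 = i) with
  | left e => ecast j (M j x) e v
  | right _ => 0
  end.

Lemma dinj_fun_id x (v : M i0 x) : dinj_fun v i0 = v.
Proof.
rewrite /dinj_fun; case: pselect => // e.
by rewrite (Prop_irrelevance e erefl).
Qed.

Lemma dinj_fun_neq x (v : M i0 x) i : i0 <> i -> dinj_fun v i = 0.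
Proof. by rewrite /dinj_fun; case: pselect. Qed.

Lemma dinj_finite x (v : M i0 x) : finite_set [set i | dinj_fun v i <> 0].
Proof.
apply: sub_finite_set (finite_set1 i0) => i /= vi.
by apply: contrapT => ii0; apply: vi; apply: dinj_fun_neq => /esym.
Qed.

Definition dinj x (v : M i0 x) : cmod_dsum M x := DSum (dinj_finite v).

Lemma dinj_is_linear x : linear (@dinj x).
Proof.
move=> c v w; apply: dsum_ext => i /=.
have [<-|ii0] := pselect (i0 = i); first by rewrite !dinj_fun_id.
by rewrite !dinj_fun_neq// scaler0 addr0.
Qed.
HB.instance Definition _ x := GRing.isLinear.Build K (M i0 x) (cmod_dsum M x) _
  (@dinj x) (@dinj_is_linear x).

Lemma dinj_nat x y (f : hom x y) v :
  dinj (cmod_map (M i0) f v) = cmod_map (cmod_dsum M) f (dinj v).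
Proof.
apply: dsum_ext => i /=.
have [<-|ii0] := pselect (i0 = i); first by rewrite !dinj_fun_id.
by rewrite !dinj_fun_neq// linear0.
Qed.

Definition dinj_hom : cmod_hom (M i0) (cmod_dsum M) :=
  @CModHom K G _ _ (fun x => @dinj x) (fun x y f v => dinj_nat f v).

End DirectSumInjection.

Definition dproj I (M : I -> cmod K G) i x (v : cmod_dsum M x) : M i x :=
  (v : dsum _) i.

Lemma dproj_is_linear I (M : I -> cmod K G) i x : linear (@dproj I M i x).
Proof. by []. Qed.
HB.instance Definition _ I (M : I -> cmod K G) i x :=
  GRing.isLinear.Build K (cmod_dsum M x) (M i x) _ (@dproj I M i x) (@dproj_is_linear I M i x).

Definition dproj_hom I (M : I -> cmod K G) i : cmod_hom (cmod_dsum M) (M i) :=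
  @CModHom K G _ _ (fun x => @dproj I M i x) (fun x y f v => erefl).

Lemma comp_hom_nat (M N P : cmod K G) (g : cmod_hom N P) (f : cmod_hom M N)
    x y (u : hom x y) v :
  (g x \o f x) (cmod_map M u v) = cmod_map P u ((g y \o f y) v).
Proof. by rewrite /= !cmod_hom_nat. Qed.

Definition comp_hom (M N P : cmod K G) (g : cmod_hom N P) (f : cmod_hom M N) :
    cmod_hom M P :=
  @CModHom K G _ _ (fun x => g x \o f x) (comp_hom_nat g f).

Lemma dsum_decomp I (M : I -> cmod K G) x (v : cmod_dsum M x)
    (X : set (cmod_dsum M x)) : subspace X ->
  (forall i, X (dinj_hom M i x ((v : dsum _) i))) -> X v.
Proof.
move=> sX Xi; have [s vs] : exists s : seq {classic I}, forall i : {classic I},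
    (v : dsum _) i <> 0 -> i \in s.
  have /finite_seqP[s sE] := dsum_finite (v : dsum _) :
      finite_set ([set i | (v : dsum _) i <> 0] : set {classic I}).
  exists s => i vi; have : [set i | (v : dsum _) i <> 0] i by [].
  by rewrite sE.
have -> : v = \sum_(i <- undup s) dinj_hom M i x ((v : dsum _) i).
  have evD (w : seq {classic I}) i (F : I -> cmod_dsum M x) :
      ((\sum_(j <- w) F j : cmod_dsum M x) : dsum _) i = \sum_(j <- w) (F j : dsum _) i.
    elim: w => [|j w IH]; first by rewrite !big_nil.
    by rewrite !big_cons -IH.
  apply: dsum_ext => i; rewrite evD.
  have [/= vi0|/eqP vi] := eqVneq ((v : dsum _) i) 0.
    rewrite vi0 big1// => j _ /=.
    have [ji|ji] := pselect (j = i); last by rewrite dinj_fun_neq.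
    by subst j; rewrite dinj_fun_id.
  rewrite (bigD1_seq (i : {classic I})) ?undup_uniq ?mem_undup ?vs//=.
  rewrite dinj_fun_id big1 ?addr0// => j ji; rewrite dinj_fun_neq// => ji'.
  by rewrite ji' eqxx in ji.
by apply: (subspace_sum sX) => i _.
Qed.

Section Step.
Hypotheses (EI : EI_cat G) (free : free_cat G) (skel : skeletal G).
Variables (x : G) (L : seq (arrow_from x)) (t : arrow_from x).

(** The condition for [t] to come directly after [L] in the filtration. The first
    part makes [u |-> M(t) u] descend from S_(tag t) M to the
    quotient of M(x) by [arrow_span L], and the second part makes it injective there
    when M is projective. *)
Definition next_arrow :=
  (forall z (v : hom (tag t) z), ~ is_iso v ->
     exists2 s, s \in L & exists b : hom (tag s) z, hcomp b (tagged s) = hcomp v (tagged t)) /\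
  (forall s, s \in L -> forall g : hom (tag s) (tag t), hcomp g (tagged s) <> tagged t).

Hypothesis Lt : next_arrow.

Lemma arrow_span_noniso (M : cmod K G) (w : M (tag t)) : in_span (@noniso_image K G (tag t) M) w ->
  arrow_span x L M (cmod_map M (tagged t) w).
Proof.
apply: (in_span_min (Y := [set w | arrow_span x L M (cmod_map M (tagged t) w)])).
  have [X0 XP] := subspace_in_span [set v | exists2 s, s \in L &
    exists w : M (tag s), v = cmod_map M (tagged s) w].
  by split=> [|c u v Xu Xv] /=; rewrite ?linear0// linearP; exact: XP.
move=> _ [z [v [m [a [v_noniso ->]]]]] /=.
have va : ~ is_iso (hcomp v (sval a)).
  have [a' [a'a aa']] : is_iso (sval a) by apply/asboolP; exact: svalP a.
  move=> va; apply: v_noniso; rewrite -[v]hcompf1 -aa' hcompA.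
  by apply: is_iso_comp => //; exists (sval a).
have [s sL [b bE]] := Lt.1 _ _ va.
apply: in_span_gen; exists s => //; exists (cmod_map M b m).
by rewrite -!cmod_map_comp bE hcompA.
Qed.

(** Together with [arrow_span_noniso], this makes S_(tag t) M the graded piece of
    M(x) that [t] adds to [arrow_span L]. *)
Definition arrow_detects (M : cmod K G) := forall w : M (tag t),
  arrow_span x L M (cmod_map M (tagged t) w) -> in_span (@noniso_image K G (tag t) M) w.

(** If z differs from y = tag t, every arrow from y to z is a non-isomorphism and
    S_y K mor(?,z) = 0. If z = y, composition with [t] is injective on aut(y) because
    aut(y) acts freely, and no [f o t] with f in aut(y) factors through [L]; so
    comparing the coefficients of the arrows [f o t] shows that w = 0. *)
Lemma detects_repr z : arrow_detects (repr_cmod K z).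
Proof.
move=> w Lw; have [zt|zt] := pselect (tag t = z); last first.
  move: w {Lw}; apply: freeg_span_ind; first exact: subspace_in_span.
  move=> f; apply: in_span_gen.
  exists z, f, << idm z >>, (aut1 (tag t)); split=> [fi|].
    by apply: zt; apply: skel; exists f.
  by rewrite cmod_map_id /= freeg_mapU hcomp1f.
suff -> : w = 0 by exact: in_span0.
apply/eqP/freeg_eqP => f; rewrite coeff0.
have t_epi (g h : hom (tag t) z) : hcomp g (tagged t) = hcomp h (tagged t) -> g = h.
  subst z => gh; have [h' [h'h hh']] := EI h.
  have ia : is_iso (hcomp h' g) by exact: EI.
  pose a : aut (tag t) := exist _ (hcomp h' g) (introT (asboolP _) ia).
  have /(congr1 (hcomp h)) : sval a = idm (tag t).
    by apply: (@free _ _ (tagged t)); rewrite /= -hcompA gh hcompA h'h hcomp1f.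
  by rewrite /= hcompA hh' hcomp1f hcompf1.
have E : coeff (hcomp f (tagged t)) (cmod_map (repr_cmod K z) (tagged t) w) = coeff f w.
  pose X : set (repr_cmod K z (tag t)) := [set w |
    coeff (hcomp f (tagged t)) (cmod_map (repr_cmod K z) (tagged t) w) = coeff f w].
  suff : X w by [].
  apply: freeg_span_ind.
    split=> [|c u v /= Eu Ev] /=; first by rewrite /X /= linear0 !coeff0.
    by rewrite /X /= linearP !coeffD !coeffZ -Eu -Ev.
  move=> g; rewrite /X /= freeg_mapU !coeffU; congr (_ * _%:R); congr nat_of_bool.
  by apply/eqP/eqP => [/t_epi|->].
rewrite -{}E; move: Lw.
apply: (in_span_min (Y := [set v : repr_cmod K z x | coeff (hcomp f (tagged t)) v = 0])).
  split=> [|c u v /= Eu Ev]; first exact: coeff0.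
  by rewrite /= coeffD coeffZ Eu Ev mulr0 addr0.
move=> _ [s sL [m ->]] /=.
pose X : set (repr_cmod K z (tag s)) := [set m |
  coeff (hcomp f (tagged t)) (cmod_map (repr_cmod K z) (tagged s) m) = 0].
suff : X m by [].
apply: freeg_span_ind.
  split=> [|c u v /= Eu Ev] /=; first by rewrite /X /= linear0 coeff0.
  by rewrite /X /= linearP coeffD coeffZ Eu Ev mulr0 addr0.
move=> g; rewrite /X /= freeg_mapU coeffU mul1r; case: eqP => // gE.
subst z; have [f' [f'f _]] := EI f; case: (Lt.2 s sL (hcomp f' g)).
by rewrite -hcompA gE hcompA f'f hcomp1f.
Qed.

Lemma detects_dsum I (M : I -> cmod K G) :
  (forall i, arrow_detects (M i)) -> arrow_detects (cmod_dsum M).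
Proof.
move=> detM w Lw; apply: dsum_decomp; first exact: subspace_in_span.
move=> i; apply: noniso_span_nat; apply: detM.
exact: (arrow_span_dsum i Lw).
Qed.

Lemma detects_retract (M N : cmod K G) (f : cmod_hom M N) (g : cmod_hom N M) :
  (forall y, cancel (f y) (g y)) -> arrow_detects N -> arrow_detects M.
Proof.
move=> fK detN w Lw; rewrite -(fK _ w); apply: noniso_span_nat; apply: detN.
by rewrite -cmod_hom_nat; exact: arrow_span_nat.
Qed.

(** Being natural in M, the property passes to direct sums and to retracts. *)
Lemma detects_projective (P : cmod K G) : projective P -> arrow_detects P.
Proof.
move=> [I [y [Q [f [g fg]]]]].
have detF := detects_dsum (fun i => @detects_repr (y i)).
apply: (detects_retract (f := comp_hom f (dinj_hom (fun b : bool => if b then P else Q) true))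
  (g := comp_hom (dproj_hom (fun b : bool => if b then P else Q) true) g)) detF.
by move=> z v /=; rewrite (fg z).1 /= dinj_fun_id.
Qed.

End Step.
End ArrowFiltration.

(** * Finite types from finiteness proofs *)

Section FinOf.
Variables (T : choiceType) (finT : finite_set [set: T]).

(** The carrier is T itself; indexing by the proof of finiteness is what lets a
    canonical finType structure be attached to it. *)
Definition finof of finite_set [set: T] : predArgType := Choice.sort T.
HB.instance Definition _ := Choice.on (finof finT).

Let s : seq T := enum_fset (fset_set [set: T]).
Let mem_s x : x \in s.
Proof. by rewrite /s in_fset_set// in_setT. Qed.

Definition finof_unpickle (n : nat) : option (finof finT) :=
  ohead (drop n s).

Lemma finof_pickleK : pcancel (fun x : finof finT => index (x : T) s) finof_unpickle.
Proof.
move=> x; rewrite /finof_unpickle (drop_nth x) ?index_mem ?mem_s//=.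
by rewrite nth_index ?mem_s.
Qed.
HB.instance Definition _ := Choice_isCountable.Build (finof finT) finof_pickleK.

Lemma finof_enumP : Finite.axiom (s : seq (finof finT)).
Proof. move=> x; rewrite count_uniq_mem; last exact: fset_uniq.
by have -> : x \in (s : seq (finof finT)) := mem_s x. Qed.
HB.instance Definition _ := fintype.isFinite.Build (finof finT) finof_enumP.

Lemma card_finof : #|finof finT| = ncard T.
Proof. by rewrite cardE enumT unlock. Qed.

Lemma fsbig_finof (V : nmodType) (f : T -> V) :
  \sum_(x \in [set: T]) f x = \sum_(x : finof finT) f x.
Proof.
have sE : index_enum (finof finT) = s :> seq (finof finT).
  by rewrite [index_enum _]unlock unlock.
by rewrite (@fsbig_finite _ _ _ T)//= sE.
Qed.
End FinOf.

Lemma ncard_bij (S T : choiceType) (f : S -> T) : finite_set [set: S] -> finite_set [set: T] ->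
  bijective f -> ncard S = ncard T.
Proof.
move=> fS fT bf; rewrite -(card_finof fS) -(card_finof fT).
exact: (@bij_eq_card (finof fS) (finof fT) f bf).
Qed.

(** * Enumerating the arrows out of an object *)

Section FiniteEI.
Variable G : category.
Hypotheses (EI : EI_cat G) (free : free_cat G) (skel : skeletal G).
Hypotheses (fin_ob : finite_set [set: G])
  (fin_hom : forall x y : G, finite_set [set: hom x y]).

Local Notation obF := (finof fin_ob).
Local Notation homF x y := (finof (fin_hom x y)).

(** Both composites are endomorphisms, hence isomorphisms. *)
Lemma iso_of_back (x y : G) (f : hom x y) (g : hom y x) : is_iso f.
Proof.
have [k [kgf _]] := EI (hcomp g f); have [l [_ fgl]] := EI (hcomp f g).
exists (hcomp k g); have kgE : hcomp k g = hcomp g l.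
  by rewrite -[LHS]hcompf1 -fgl -!hcompA (hcompA g f) hcompA kgf hcomp1f.
by split; [rewrite -hcompA|rewrite kgE hcompA].
Qed.

Lemma noniso_neq (x y : G) (f : hom x y) : ~ is_iso f -> x <> y.
Proof. by move=> nf xy; subst y; apply: nf; exact: EI. Qed.

(** Non-isomorphisms strictly decrease this number, so that one can argue by
    induction along the partial order of the objects. *)
Definition height (x : G) : nat := #|[set z : obF | `[< inhabited (hom x z) >]]|%SET.

Lemma height_lt (x y : G) (f : hom x y) : ~ is_iso f -> (height y < height x)%N.
Proof.
move=> nf; apply: proper_card; apply/properP; split.
  apply/fintype.subsetP => z; rewrite !inE => /asboolP[g].
  by apply/asboolP; exists; exact: hcomp g f.
exists x; rewrite !inE; first by apply/asboolP; exists; exact: idm x.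
by apply/asboolP => -[g]; apply: nf; exact: iso_of_back f g.
Qed.

Lemma height_neq (x y : G) (f : hom x y) : x <> y -> (height y < height x)%N.
Proof. by move=> xy; apply: (height_lt (f := f)) => fi; apply: xy; apply: skel; exists f. Qed.

Lemma card_endo_gt0 (x : G) : (0 < #|homF x x|)%N.
Proof. by apply/card_gt0P; exists (idm x : homF x x). Qed.

Lemma ncard_aut (x : G) : ncard (aut x) = #|homF x x|.
Proof.
rewrite card_finof.
pose F (f : hom x x) : aut x := exist _ f (introT (asboolP _) (EI f)).
have FK : cancel F (fun a : aut x => sval a) by [].
have KF : cancel (fun a : aut x => sval a) F by move=> a; exact/val_inj.
have fa : finite_set [set: aut x].
  have -> : [set: aut x] = F @` [set: hom x x].
    by apply/seteqP; split=> // a _; exists (sval a).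
  exact: finite_image.
by apply/esym; apply: (ncard_bij (f := F)) => //; exact: Bijective FK KF.
Qed.

Section Arrows.
Variable x : G.

Definition arrow_fin : finType := {y : obF & homF x y}.
Implicit Types s t : arrow_fin.

Definition same_orbit s t : bool :=
  `[< exists b : hom (tag s : G) (tag t), is_iso b /\ hcomp b (tagged s) = tagged t >].

Lemma same_orbit_tag s t : same_orbit s t -> tag s = tag t.
Proof. by move=> /asboolP[b [bi _]]; apply: skel; exists b. Qed.

Lemma same_orbit_refl s : same_orbit s s.
Proof. by apply/asboolP; exists (idm _); split; [exact: is_iso_id|rewrite hcomp1f]. Qed.

Lemma same_orbit_sym s t : same_orbit s t -> same_orbit t s.
Proof.
move=> /asboolP[b [[b' [b'b bb']] bE]]; apply/asboolP; exists b'; split; first by exists b.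
by rewrite -bE hcompA b'b hcomp1f.
Qed.

Lemma same_orbit_trans s t u : same_orbit s t -> same_orbit t u -> same_orbit s u.
Proof.
move=> /asboolP[b [bi bE]] /asboolP[c [ci cE]]; apply/asboolP; exists (hcomp c b).
by split; [exact: is_iso_comp|rewrite -hcompA bE].
Qed.

Definition orbit_rep t : arrow_fin := odflt t [pick s | same_orbit t s].

Lemma orbit_rep_same t : same_orbit t (orbit_rep t).
Proof. by rewrite /orbit_rep; case: pickP => //= _; exact: same_orbit_refl. Qed.

Lemma orbit_repE s t : same_orbit s t -> orbit_rep s = orbit_rep t.
Proof.
move=> st; have E : same_orbit s =1 same_orbit t.
  move=> u; apply/idP/idP; apply: same_orbit_trans => //; exact: same_orbit_sym.
rewrite /orbit_rep (eq_pick E); case: pickP => // /(_ t).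
by rewrite same_orbit_refl.
Qed.

Lemma orbit_rep_id t : orbit_rep (orbit_rep t) = orbit_rep t.
Proof. by apply/esym/orbit_repE/orbit_rep_same. Qed.

(** The orbit is the image of a |-> a o s, which is injective on aut(tag s) because
    the action is free. *)
Lemma card_orbit s : orbit_rep s = s ->
  #|[pred u | orbit_rep u == s]| = #|homF (tag s) (tag s)|.
Proof.
move=> sE; pose y : G := tag s.
pose F (a : homF y y) : arrow_fin :=
  Tagged (fun y : obF => homF x y) (hcomp a (tagged s) : homF x y).
have F_inj : injective F.
  move=> a b /eqP; rewrite /F eq_Tagged /= => /eqP ab.
  have [b' [b'b bb']] := EI (b : hom y y).
  have ia : is_iso (hcomp b' a) by exact: EI.
  pose c : aut y := exist _ (hcomp b' a) (introT (asboolP _) ia).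
  have /(congr1 (hcomp b)) : sval c = idm y.
    by apply: (@free _ _ (tagged s)); rewrite /= -hcompA ab hcompA b'b hcomp1f.
  by rewrite /= hcompA bb' hcomp1f hcompf1.
rewrite -(fintype.card_image F_inj); apply: eq_card => u; rewrite !inE.
apply/eqP/fintype.imageP => [us|[a _ ->]].
  have : same_orbit s u by apply: same_orbit_sym; rewrite -us; exact: orbit_rep_same.
  move=> /[dup] /same_orbit_tag tE /asboolP; case: u us tE => z u us /= tE.
  by subst z => -[b [_ bE]]; exists (b : homF y y) => //; rewrite /F bE.
rewrite -[RHS]sE; apply/esym/orbit_repE; apply/asboolP; exists a.
by split=> //; exact: EI.
Qed.

Lemma sum_orbit_reps (f : G -> rat) :
  \sum_(s : arrow_fin | (tag s != x) && (orbit_rep s == s)) f (tag s) =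
  \sum_(y : obF | y != x) #|homF x y|%:R / #|homF y y|%:R * f y.
Proof.
transitivity (\sum_(u : arrow_fin | tag u != x) f (tag u) / #|homF (tag u) (tag u)|%:R).
  rewrite [RHS](partition_big orbit_rep (fun s => (tag s != x) && (orbit_rep s == s)))/=.
    apply: eq_bigr => s /andP[sx /eqP sE].
    rewrite (eq_bigl (fun u => orbit_rep u == s)); last first.
      move=> u /=; case: (orbit_rep u =P s) => [us|]; rewrite ?andbF// andbT.
      by rewrite (same_orbit_tag (orbit_rep_same u)) us.
    rewrite (eq_bigr (fun=> f (tag s) / #|homF (tag s) (tag s)|%:R)); last first.
      by move=> u /eqP us; rewrite (same_orbit_tag (orbit_rep_same u)) us.
    rewrite sumr_const card_orbit// -[RHS]mulr_natr -mulrA mulVf ?mulr1//.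
    by rewrite pnatr_eq0 -lt0n card_endo_gt0.
  by move=> u ux; rewrite -(same_orbit_tag (orbit_rep_same u)) ux orbit_rep_id eqxx.
under eq_bigl => u do rewrite -[_ != x]andbT.
rewrite -(@sig_big_dep _ _ _ _ _ (fun y : obF => y != x) (fun _ _ => true)
  (fun y _ => f y / #|homF y y|%:R))/=.
apply: eq_bigr => y _; rewrite sumr_const -[LHS]mulr_natl -mulrA.
by rewrite [f y / _]mulrC.
Qed.

(** The list consists of representatives of the aut(y)-orbits of mor(x,y), for all
    y <> x, in the order of increasing height of y. If v is a non-isomorphism out of
    the target of t, then v o t has a target of smaller height, so its representative
    comes before t. If t = g o s with s before t, then g cannot decrease the height,
    so it is an isomorphism and s, t represent the same orbit. The identity of x has the
    target of greatest height and comes after all of them. *)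
Lemma arrow_list : exists L : seq (arrow_from x),
  [/\ forall L1 t L2, L = L1 ++ t :: L2 -> next_arrow L1 t,
      next_arrow L (Tagged (fun y => hom x y) (idm x) : arrow_from x),
      forall s, s \in L -> (height (tag s) < height x)%N &
      forall f : G -> rat, \sum_(s <- L) f (tag s) =
        \sum_(y : obF | y != x) #|homF x y|%:R / #|homF y y|%:R * f y].
Proof.
pose le s t := (height (tag s) <= height (tag t))%N.
have le_tr : transitive le by move=> s t u; exact: leq_trans.
have le_tot : total le by move=> s t; exact: leq_total.
pose L0 := [seq s <- enum arrow_fin | (tag s != x) && (orbit_rep s == s)].
pose L := sort le L0.
have mL s : s \in L = (tag s != x) && (orbit_rep s == s).
  by rewrite mem_sort mem_filter mem_enum andbT.
have uL : uniq L by rewrite sort_uniq filter_uniq// enum_uniq.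
have hL s : s \in L -> (height (tag s) < height x)%N.
  by rewrite mL => /andP[/eqP sx _]; apply: (height_neq (tagged s)) => /esym.
have repL z (v : hom x z) : z <> x -> exists2 s, s \in L &
    tag s = z /\ exists b : hom (tag s) z, hcomp b (tagged s) = v.
  move=> zx; pose u : arrow_fin := Tagged (fun y : obF => homF x y) (v : homF x z).
  exists (orbit_rep u).
    rewrite mL orbit_rep_id eqxx andbT -(same_orbit_tag (orbit_rep_same u)).
    exact/eqP.
  split; first by rewrite -(same_orbit_tag (orbit_rep_same u)).
  by have /same_orbit_sym/asboolP[b [_ bE]] := orbit_rep_same u; exists b.
have sL : pairwise le L by rewrite -(sorted_pairwise le_tr); exact: sort_sorted.
exists L; split=> //.
- move=> L1 t L2 LE.
  have tL : t \in L by rewrite LE mem_cat mem_head orbT.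
  move: sL uL; rewrite LE pairwise_cat cat_uniq => /and3P[/allrelP L12 _ /= /andP[/allP tL2 _]].
  move=> /and3P[_ + _]; rewrite negb_or => /andP[tnL1 _].
  split=> [z v v_noniso|s sL1 g gE].
    have hz := height_lt v_noniso.
    have zx : z <> x.
      by move=> zx; move: (ltn_trans hz (hL _ tL)); rewrite zx ltnn.
    have [s sL' [sz bE]] := repL z (hcomp v (tagged t)) zx.
    exists s => //; move: sL'; rewrite LE mem_cat inE => /or3P[//|/eqP st|/tL2].
      by move: hz; rewrite -sz st ltnn.
    by rewrite /le sz leqNgt hz.
  have hst : (height (tag s) <= height (tag t))%N by apply: L12 => //; exact: mem_head.
  have [gi|/height_lt] := pselect (is_iso g); last by rewrite ltnNge hst.
  have st : same_orbit s t by apply/asboolP; exists g.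
  have sL' : s \in L by rewrite LE mem_cat sL1.
  move: (tL) (sL'); rewrite !mL => /andP[_ /eqP tE] /andP[_ /eqP sE].
  by move: tnL1; rewrite -tE -(orbit_repE st) sE sL1.
- split=> [z v v_noniso|s /hL hs g _].
    have /= /nesym zx := noniso_neq v_noniso.
    have [s sL' [_ bE]] := repL z v zx; exists s => //.
    by rewrite /= hcompf1.
  have [sx|/(height_neq g)] := pselect (tag s = x); first by rewrite sx ltnn in hs.
  by rewrite ltnNge ltnW.
- move=> f; rewrite -sum_orbit_reps.
  rewrite (perm_big L0) ?perm_sort// big_filter.
  exact: (@big_enum_cond _ _ _ arrow_fin predT
    (fun s => (tag s != x) && (orbit_rep s == s)) (fun s => f (tag s))).
Qed.

End Arrows.
End FiniteEI.

(** * Euler characteristics of projective resolutions *)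

Section ResolutionEuler.
Variables (K : fieldType) (G : category).
Hypotheses (EI : EI_cat G) (free : free_cat G) (skel : skeletal G).
Hypotheses (fin_ob : finite_set [set: G])
  (fin_hom : forall x y : G, finite_set [set: hom x y]).
Local Notation obF := (finof fin_ob).
Local Notation homF x y := (finof (fin_hom x y)).

Variable P : resolution (const_cmod K G).
Hypothesis projP : projective_resolution P.

Let C (x : G) (p : nat) : lmodType K := P p x.
Let d (x : G) p : {linear C x p.+1 -> C x p} := res_d P p x.

Let dd x : is_complex (d x).
Proof. by move=> p v; apply: (res_exactS (r := P) _).2; exists v. Qed.
Let dd0 x v : res_aug P x (d x 0 v) = 0.
Proof. by apply: (res_exact0 (r := P) _).2; exists v. Qed.

Let whole (x : G) p : set (C x p) := setT.
Let noniso (x : G) p : set (C x p) := in_span (@noniso_image K G x (P p)).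
Let span (x : G) (L : seq (arrow_from x)) p : set (C x p) := arrow_span L (M := P p).
Arguments whole : clear implicits.
Arguments noniso : clear implicits.
Arguments span : clear implicits.

Let sub_whole x : subcomplex (d x) (whole x).
Proof. by split=> // p; exact: subspaceT. Qed.
Let sub_noniso x : subcomplex (d x) (noniso x).
Proof. by split=> [p|p v]; [exact: subspace_in_span|exact: noniso_span_nat]. Qed.
Let sub_span x L : subcomplex (d x) (span x L).
Proof. by split=> [p|p v]; [exact: subspace_in_span|exact: arrow_span_nat]. Qed.

(** e is the Euler characteristic of the complex S_x P. *)
Definition euler_at (x : G) (e : int) : Prop := euler (d x) (whole x) (noniso x) e.

(** Composing with [t] identifies S_(tag t) P with a subquotient of the filtration
    of P(x). *)
Lemma euler_step x L (t : arrow_from x) e : next_arrow L t ->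
  euler_at (tag t) e <-> euler (d x) (span x (rcons L t)) (span x L) e.
Proof.
move=> Lt; apply: (@euler_iso K _ _ (d (tag t)) (d x) (fun p => cmod_map (P p) (tagged t))) => //.
- by move=> p v; rewrite cmod_hom_nat.
- move=> p; split=> [v _|v|v _|w].
  + by apply/arrow_span_rcons; exists v; rewrite subrr; exact: in_span0.
  + exact: arrow_span_noniso.
  + exact: (detects_projective EI free skel Lt (projP p)).
  + by move=> /arrow_span_rcons[v ?]; exists v.
Qed.

Lemma euler_list x (L : seq (arrow_from x)) (e : G -> int) :
  (forall L1 t L2, L = L1 ++ t :: L2 -> next_arrow L1 t) ->
  (forall s, s \in L -> euler_at (tag s) (e (tag s))) ->
  euler (d x) (span x L) (span x [::]) (\sum_(s <- L) e (tag s)).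
Proof.
elim/last_ind: L => [|L t IH] nextL eL.
  by rewrite big_nil; apply: euler_trivial.
rewrite big_rcons /=; apply: (@euler_ext _ _ _ _ (span x L)) => //.
- by move=> p v; apply: arrow_span_sub.
- by move=> p v; apply: arrow_span_sub => s; rewrite mem_rcons inE orbC => ->.
- apply: IH => [L1 s L2 LE|s sL]; last by apply: eL; rewrite mem_rcons inE sL orbT.
  by apply: (nextL _ _ (rcons L2 t)); rewrite LE rcons_cat.
- apply/euler_step; first by apply: (nextL _ _ [::]); rewrite cats1.
  by apply: eL; rewrite mem_rcons mem_head.
Qed.

(** P(x) is a resolution of K; the span of the empty list is the zero subcomplex. *)
Lemma euler_whole x : euler (d x) (whole x) (span x [::]) 1.
Proof.
have sB p := subspace_rbnd p (sub_whole x) (sub_span [::]).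
have span0 p v : span x [::] p v -> v = 0.
  by apply: (in_span_min (subspace_zero _)) => u [].
have h0 : rdim (rcyc (d x) (whole x) (span x [::]) 0)
               (rbnd (d x) (whole x) (span x [::]) 0) 1.
  have [u uE] := res_aug_surj P (x := x) (1 : K^o).
  exists (fun=> u); split=> // [v _|c].
    exists (const_mx (res_aug P x v : K^o)).
    rewrite /lincomb big_ord1 mxE.
    have /res_exact0[w wE] : res_aug P x (v - (res_aug P x v : K^o) *: u) = 0.
      by rewrite linearB linearZ_LR uE /= [_ *: _]mulr1 subrr.
    exists w => //; rewrite /d wE subrr; exact: subspace0 (proj1 (sub_span [::]) _).
  rewrite /lincomb big_ord1 => -[w _ /span0/eqP]; rewrite subr_eq0 => /eqP cE.
  apply/rowP => i; rewrite ord1 mxE.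
  have := dd0 w; rewrite -cE linearZ_LR uE /= => /eqP.
  by rewrite [_ *: _]mulr1 => /eqP.
have hS p : rdim (rcyc (d x) (whole x) (span x [::]) p.+1)
                 (rbnd (d x) (whole x) (span x [::]) p.+1) 0.
  exists (fun=> 0); split=> [[]//|v [_ /span0 dv]|c _]; last exact: thinmx0.
  have [w wE] := (res_exactS (r := P) v).1 dv.
  exists 0; rewrite linear0 subr0; exists w => //.
  rewrite /d wE subrr; exact: subspace0 (proj1 (sub_span [::]) _).
exists 1%N; split=> [[|p]|[|p]//|].
- by exists 1%N.
- by exists 0%N.
- by move=> _; apply: rdE (hS p).
- by rewrite big_ord1 expr0 mul1r (rdE _ h0).
Qed.

(** The whole of P(x) has Euler characteristic 1, the list accounts for the part
    that lies below S_x P. *)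
Lemma euler_at_step x (L : seq (arrow_from x)) (e : G -> int) :
  (forall L1 t L2, L = L1 ++ t :: L2 -> next_arrow L1 t) ->
  next_arrow L (Tagged (fun y => hom x y) (idm x) : arrow_from x) ->
  (forall s, s \in L -> euler_at (tag s) (e (tag s))) ->
  euler_at x (1 - \sum_(s <- L) e (tag s)).
Proof.
move=> nextL nextx eL.
apply/(euler_step _ nextx).
have -> : span x (rcons L (Tagged (fun y => hom x y) (idm x) : arrow_from x)) = whole x.
  apply: functional_extensionality_dep => p; apply/seteqP; split=> // v _.
  apply/arrow_span_rcons; exists v; rewrite /= cmod_map_id subrr; exact: in_span0.
apply: (@euler_quot _ _ _ (span x [::])) => //.
- by move=> p v; apply: arrow_span_sub.
- exact: euler_list.
- exact: euler_whole.
Qed.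

(** Existence is by induction on the height. The equation says that P(x), whose
    Euler characteristic is 1, is filtered by |mor(x,y)|/|aut(y)| copies of S_y P for
    each y: this is the weighting equation for y |-> e y / |aut(y)|. *)
Lemma euler_objects : exists e : G -> int,
  (forall x, euler_at x (e x)) /\
  forall x, \sum_(y : obF) #|homF x y|%:R * ((e y)%:~R / #|homF y y|%:R) = 1 :> rat.
Proof.
have key x (e : G -> int) :
    (forall y, (height fin_ob y < height fin_ob x)%N -> euler_at y (e y)) ->
    exists2 e' : int, euler_at x e' &
      e'%:~R = 1 - \sum_(y : obF | y != x) #|homF x y|%:R / #|homF y y|%:R * (e y)%:~R :> rat.
  move=> eH; have [L [nextL nextx hL sumL]] := arrow_list EI free skel fin_ob fin_hom x.
  exists (1 - \sum_(s <- L) e (tag s)).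
    by apply: euler_at_step => // s /hL/eH.
  by rewrite -sumL rmorphB rmorph1 rmorph_sum.
have ex_e x : exists e, euler_at x e.
  have [n] := ubnP (height fin_ob x); elim: n x => // n IH x; rewrite ltnS => hx.
  have /choice[e eE] y : exists e, (height fin_ob y < height fin_ob x)%N -> euler_at y e.
    have [hy|_] := ltnP (height fin_ob y) (height fin_ob x); last by exists 0.
    by have [e ye] := IH y (leq_trans hy hx); exists e.
  by have [e' ? _] := key x e eE; exists e'.
have /choice[e eE] := ex_e; exists e; split=> // x.
have [e' e'E] := key x e (fun y _ => eE y).
rewrite -(euler_uniq (eE x) e'E) => exE.
rewrite (bigD1 (x : obF))//= mulrCA divff; last first.
  by rewrite pnatr_eq0 -lt0n card_endo_gt0.
rewrite mulr1 exE addrAC -addrA [X in _ + X](_ : _ = 0) ?addr0//.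
apply/eqP; rewrite subr_eq0; apply/eqP; apply: eq_bigr => y _.
by rewrite mulrA mulrAC.
Qed.

Lemma betti_euler (R : realType) x e : euler_at x e -> exists N (b : nat -> nat),
  [/\ forall p, L2_betti R P x p = ((b p)%:R / (ncard (aut x))%:R)%:E,
      forall p, (N <= p)%N -> b p = 0%N &
      e = \sum_(p < N) (-1) ^+ p * (b p)%:Z].
Proof.
pose D p : lmodType K := S_tensor x (P p).
pose dD p : {linear D p.+1 -> D p} := S_tensor_map x (res_d P p).
have ddD : is_complex dD.
  move=> p t; have [v <-] := S_tensor_pi_surj t.
  by rewrite /dD !S_tensor_pi_nat [res_d P p x _]dd linear0.
have sW : subcomplex dD (fun p => [set: D p]) by split=> // p; exact: subspaceT.
have s0 : subcomplex dD (fun p => [set (0 : D p)]).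
  by split=> [p|p v ->]; [exact: subspace_zero|exact: (linear0 (dD p))].
have eqv : euler_at x e <-> euler dD (fun p => [set: D p]) (fun p => [set 0]) e.
  apply: (@euler_iso K _ _ (d x) dD
    (fun p => @S_tensor_pi K G x (P p) : {linear C x p -> D p})) => //.
  - by move=> p v; rewrite /dD S_tensor_pi_nat.
  - move=> p; split=> [//|v /S_tensor_pi_ker//|v _ /S_tensor_pi_ker//|w _].
    by have [v <-] := S_tensor_pi_surj w; exists v => //=; rewrite subrr.
case/eqv=> N [fN vN eE]; exists N, (fun p => rd (rcyc dD (fun p => [set: D p]) (fun p => [set 0]) p)
  (rbnd dD (fun p => [set: D p]) (fun p => [set 0]) p)); split=> // p.
rewrite /L2_betti /dim_vN (@dimE_rdim K R _ (rd (rcyc dD (fun p => [set: D p]) (fun p => [set 0]) p)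
  (rbnd dD (fun p => [set: D p]) (fun p => [set 0]) p))) //.
by apply: (homology_rdim p _ ddD).2; apply: fdimP; exact: fN.
Qed.

End ResolutionEuler.

(** * Sums over finite supports *)

Section FiniteSums.
Variable R : realType.

Lemma esum_finite_support (T : choiceType) (a : T -> R) (r : seq T) :
  uniq r -> (forall t, 0 <= a t) -> (forall t, t \notin r -> a t = 0) ->
  (\esum_(t in [set: T]) (a t)%:E = (\sum_(t <- r) a t)%:E)%E.
Proof.
move=> ur a0 ar.
have -> : (\esum_(t in [set: T]) (a t)%:E = \esum_(t in [set` r]) (a t)%:E)%E.
  rewrite [RHS]esum_mkcond; apply: eq_esum => t _.
  case: ifPn => // tr; rewrite ar//; apply: contra tr => tr.
  exact/mem_set.
rewrite esum_fset; first last.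
- by move=> t _; rewrite lee_fin.
- exact: finite_seq.
by rewrite -fsbig_seq// sumEFin.
Qed.

Lemma abs_sum_finite_support (T : choiceType) (a : T -> R) (r : seq T) :
  uniq r -> (forall t, t \notin r -> a t = 0) -> abs_sum a = \sum_(t <- r) a t.
Proof.
move=> ur ar; rewrite /abs_sum !(esum_finite_support ur) /=.
- rewrite -sumrB; apply: eq_bigr => t _.
  rewrite /Num.max; case: ltP => a0; case: ltP => na0; lra.
- by move=> t; rewrite le_max lexx orbT.
- by move=> t /ar ->; rewrite oppr0 maxxx.
- by move=> t; rewrite le_max lexx orbT.
- by move=> t /ar ->; rewrite maxxx.
Qed.

End FiniteSums.

(** * Leinster's Euler characteristic *)

Section Leinster.
Variable G : category.
Hypotheses (EI : EI_cat G) (skel : skeletal G).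
Hypotheses (fin_ob : finite_set [set: G])
  (fin_hom : forall x y : G, finite_set [set: hom x y]).
Local Notation obF := (finof fin_ob).
Local Notation homF x y := (finof (fin_hom x y)).

Lemma weightingP (k : G -> rat) :
  weighting k <-> forall x, \sum_(y : obF) #|homF x y|%:R * k y = 1.
Proof.
have E x : \sum_(y \in [set: G]) (ncard (hom x y))%:R * k y =
  \sum_(y : obF) #|homF x y|%:R * k y.
  by rewrite (fsbig_finof fin_ob); apply: eq_bigr => y _; rewrite card_finof.
by split=> kw x; [rewrite -E; exact: kw|rewrite E].
Qed.

Lemma coweightingP (l : G -> rat) :
  coweighting l <-> forall y, \sum_(x : obF) #|homF x y|%:R * l x = 1.
Proof.
have E y : \sum_(x \in [set: G]) (ncard (hom x y))%:R * l x =
  \sum_(x : obF) #|homF x y|%:R * l x.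
  by rewrite (fsbig_finof fin_ob); apply: eq_bigr => x _; rewrite card_finof.
by split=> lw y; [rewrite -E; exact: lw|rewrite /= E].
Qed.

(** Ordered by height, the matrix of the numbers |mor(x,y)| is triangular, with the
    nonzero diagonal entries |aut(x)|. *)
Lemma zeta_inj (k : G -> rat) :
  (forall x, \sum_(y : obF) #|homF x y|%:R * k y = 0) -> forall x, k x = 0.
Proof.
move=> k0 x; have [n] := ubnP (height fin_ob x); elim: n x => // n IH x.
rewrite ltnS => hx; move: (k0 x); rewrite (bigD1 (x : obF))//= big1 ?addr0.
  move=> /eqP; rewrite mulf_eq0 pnatr_eq0 => /orP[|/eqP//].
  by rewrite -leqn0 leqNgt card_endo_gt0.
move=> y yx; have [|h0] := posnP #|homF x y|; first by move=> ->; rewrite mul0r.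
have /card_gt0P[f _] := h0.
rewrite IH ?mulr0//; apply: leq_trans hx.
by apply: (height_neq EI skel fin_ob (f : hom x y)) => xy; rewrite -xy eqxx in yx.
Qed.

Lemma exists_coweighting : exists l : G -> rat, coweighting l.
Proof.
pose M : 'M[rat]_#|obF| := \matrix_(i, j)
  #|homF (@enum_val obF predT i : G) (@enum_val obF predT j : G)|%:R.
have Mu : M \in unitmx.
  rewrite -unitmx_tr -row_free_unit; apply: inj_row_free => v vM.
  have kv := @zeta_inj (fun x : G => v ord0 (enum_rank (x : obF))) _.
  apply/rowP => i; rewrite mxE -(enum_valK i); apply: kv => x.
  have /rowP/(_ (enum_rank (x : obF))) := vM; rewrite !mxE => vMx.
  rewrite -[RHS]vMx (reindex (@enum_val obF predT))/=; last exact: onW_bij (enum_val_bij _).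
  by apply: eq_bigr => j _; rewrite !mxE enum_rankK enum_valK mulrC.
pose l : 'rV[rat]_#|obF| := const_mx 1 *m invmx M.
exists (fun x : G => l ord0 (enum_rank (x : obF))); apply/coweightingP => y.
have : l *m M = const_mx 1 by rewrite mulmxKV.
move=> /rowP/(_ (enum_rank (y : obF))); rewrite !mxE => lM.
rewrite -[RHS]lM (reindex (@enum_val obF predT))/=; last exact: onW_bij (enum_val_bij _).
by apply: eq_bigr => j _; rewrite [M _ _]mxE enum_rankK enum_valK mulrC.
Qed.

(** Both sides equal the sum of l x |mor(x,y)| k y over all x and y. *)
Lemma weight_coweight (k l : G -> rat) : weighting k -> coweighting l ->
  \sum_(y : obF) k y = \sum_(x : obF) l x.
Proof.
move=> /weightingP kw /coweightingP lw.
rewrite (eq_bigr (fun y => (\sum_(x : obF) #|homF x y|%:R * l x) * k y)); last first.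
  by move=> y _; rewrite (lw y) mul1r.
rewrite (eq_bigr (fun y => \sum_(x : obF) #|homF x y|%:R * l x * k y)); last first.
  by move=> y _; rewrite mulr_suml.
rewrite exchange_big /=; apply: eq_bigr => x _.
transitivity (l x * \sum_(y : obF) #|homF x y|%:R * k y); last by rewrite kw mulr1.
by rewrite mulr_sumr; apply: eq_bigr => y _; rewrite mulrAC mulrC.
Qed.

Lemma chiLE (k : G -> rat) : weighting k -> chiL G = \sum_(y : obF) k y.
Proof.
move=> kw; rewrite /chiL; case: xgetP => [_ -> [k' [l' [kw' lw' _ ->]]]|].
  by rewrite (fsbig_finof fin_ob) (weight_coweight kw lw').
have [l lw] := exists_coweighting => /(_ (\sum_(y : obF) k y)); case.
exists k, l; split; rewrite ?(fsbig_finof fin_ob)//.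
exact: weight_coweight.
Qed.

End Leinster.

(** * The L2-Euler characteristic of any projective resolution *)

Section L2EulerCharacteristic.
Variables (K : fieldType) (R : realType) (G : category).
Hypotheses (EI : EI_cat G) (free : free_cat G) (skel : skeletal G).
Hypothesis fin : finite_cat G.

Lemma repr_bij : bijective (fun c : iso_class G => repr c).
Proof.
exists (fun x => \pi_(iso_class G) x)%qT => [c|x]; first exact: reprK.
have /eqmodP : (repr (\pi_(iso_class G) x) = x %[mod iso_class G])%qT by rewrite reprK.
by move=> /asboolP; exact: skel.
Qed.

Lemma skeletal_finite_ob : finite_set [set: G].
Proof.
have -> : [set: G] = (fun c : iso_class G => repr c) @` [set: iso_class G].
  by apply/seteqP; split=> // x _; have [g _ gK] := repr_bij; exists (g x).
by apply: finite_image; exact: fin.1.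
Qed.

Local Notation obF := (finof skeletal_finite_ob).

(** No comparison of resolutions is involved: for every P the numbers
    chi(S_y P)/|aut(y)| solve the weighting equations, and these determine the sum. *)
Lemma L2_any_resolution (P : resolution (const_cmod K G)) : projective_resolution P ->
  [/\ (L2_sum R P < +oo)%E, (exists k : G -> rat, weighting k) &
      L2_alt_sum R P = ratr (chiL G)].
Proof.
move=> projP.
have [e [eE ew]] := euler_objects EI free skel skeletal_finite_ob fin.2 projP.
have kw : weighting (fun y : G => (e y)%:~R / #|finof (fin.2 y y)|%:R).
  by apply/(weightingP skeletal_finite_ob fin.2).
have bettiE x := betti_euler R (eE x).
have /choice[N /choice[b bE]] := bettiE.
pose r : seq (iso_class G) := enum_fset (fset_set [set: iso_class G]).
have ur : uniq r by exact: fset_uniq.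
have mr c : c \in r by rewrite /r (in_fset_set fin.1) in_setT.
have betti_out x p : p \notin iota 0 (N x) -> b x p = 0%N.
  by rewrite mem_iota add0n /= -leqNgt; have [_ + _] := bE x; apply.
split.
- rewrite /L2_sum.
  pose s x := \sum_(p <- iota 0 (N x)) (b x p)%:R / (ncard (aut x))%:R : R.
  have sE x : (\esum_(p in [set: nat]) L2_betti R P x p = (s x)%:E)%E.
    rewrite -(esum_finite_support (iota_uniq _ _)); last 2 first.
    + by move=> p; rewrite divr_ge0.
    + by move=> p /betti_out ->; rewrite mul0r.
    by apply: eq_esum => p _; have [-> _ _] := bE x.
  under eq_esum do rewrite sE.
  rewrite (esum_finite_support ur); first by rewrite ltry.
  + by move=> c; apply: sumr_ge0 => p _; rewrite divr_ge0.
  + by move=> c; rewrite mr.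
- by exists (fun y : G => (e y)%:~R / #|finof (fin.2 y y)|%:R).
- rewrite (chiLE EI skel skeletal_finite_ob fin.2 kw) rmorph_sum /= /L2_alt_sum.
  have sE x : abs_sum (fun p : nat => (-1) ^+ p * fine (L2_betti R P x p)) =
      ratr ((e x)%:~R / #|finof (fin.2 x x)|%:R) :> R.
    rewrite (abs_sum_finite_support (iota_uniq 0 (N x))); last first.
      by move=> p /betti_out bp; have [-> _ _] := bE x; rewrite bp mul0r /= mulr0.
    have [Lb _ ->] := bE x.
    rewrite rmorphM /= fmorphV /= rmorph_nat rmorph_int rmorph_sum mulr_suml.
    have -> : iota 0 (N x) = index_iota 0 (N x) by rewrite /index_iota subn0.
    rewrite big_mkord; apply: eq_bigr => p _.
    by rewrite Lb /= (ncard_aut EI fin.2) rmorphM /= rmorphXn /= rmorphN1 mulrA.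
  have -> : (fun c : iso_class G =>
      abs_sum (fun p : nat => (-1) ^+ p * fine (L2_betti R P (repr c) p))) =
      fun c => ratr ((e (repr c))%:~R / #|finof (fin.2 (repr c) (repr c))|%:R).
    by apply: functional_extensionality_dep => c; rewrite sE.
  rewrite (abs_sum_finite_support ur); last by move=> c; rewrite mr.
  rewrite fsbig_seq//.
  have -> : [set` r] = [set: iso_class G] by apply/seteqP; split=> // c _; exact: mr.
  rewrite -(fsbig_finof skeletal_finite_ob
    (fun y : G => ratr ((e y)%:~R / #|finof (fin.2 y y)|%:R) : R)).
  by rewrite [RHS](reindex_fsbigT _ _ repr_bij).
Qed.

End L2EulerCharacteristic.

(** * Kernels and retracts of modules *)

Section KernelModule.
Variables (K : fieldType) (G : category) (M N : cmod K G) (f : cmod_hom M N).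

Definition ker_pred (x : G) : {pred M x} := fun v => f x v == 0.
Lemma ker_pred_closed x : submod_closed (@ker_pred x).
Proof.
split=> [|c v w]; first by rewrite unfold_in linear0.
by rewrite !unfold_in => /eqP fv /eqP fw; rewrite linearP fv fw scaler0 addr0.
Qed.
HB.instance Definition _ x := GRing.isSubmodClosed.Build K (M x) (@ker_pred x)
  (@ker_pred_closed x).

Definition ker_ob (x : G) := {v : M x | v \in @ker_pred x}.
HB.instance Definition _ x := SubChoice.on (ker_ob x).
HB.instance Definition _ x := [SubChoice_isSubLmodule of ker_ob x by <:].

Lemma ker_obP x (v : ker_ob x) : f x (val v) = 0.
Proof. by apply/eqP; exact: (valP v). Qed.

Lemma ker_map_subproof x y (u : hom x y) (v : ker_ob y) :
  cmod_map M u (val v) \in @ker_pred x.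
Proof. by rewrite unfold_in cmod_hom_nat ker_obP linear0. Qed.

Definition ker_map x y (u : hom x y) (v : ker_ob y) : ker_ob x :=
  exist _ (cmod_map M u (val v)) (ker_map_subproof u v).

Lemma ker_map_is_linear x y (u : hom x y) : linear (ker_map u).
Proof. by move=> c v w; apply: val_inj; rewrite /= linearP. Qed.
HB.instance Definition _ x y (u : hom x y) := GRing.isLinear.Build K
  (ker_ob y) (ker_ob x) _ (ker_map u) (ker_map_is_linear u).

Lemma ker_map_id x (v : ker_ob x) : ker_map (idm x) v = v.
Proof. by apply: val_inj; rewrite /= cmod_map_id. Qed.

Lemma ker_map_comp x y z (g : hom y z) (h : hom x y) v :
  ker_map (hcomp g h) v = ker_map h (ker_map g v).
Proof. by apply: val_inj; rewrite /= cmod_map_comp. Qed.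

Definition ker_cmod : cmod K G :=
  @CMod K G (fun x => ker_ob x : lmodType K)
    (fun x y u => ker_map u : {linear ker_ob y -> ker_ob x}) ker_map_id ker_map_comp.

Definition ker_incl : cmod_hom ker_cmod M :=
  @CModHom K G ker_cmod M (fun x => val : {linear ker_ob x -> M x})
    (fun x y u v => erefl).

End KernelModule.

Section RetractSummand.
Variables (K : fieldType) (G : category) (P F : cmod K G).
Variables (i : cmod_hom P F) (p : cmod_hom F P).
Hypothesis ipK : forall x, cancel (i x) (p x).

Let Q := ker_cmod p.
Let S := cmod_sum2 P Q.

Let to_fun x (v : S x) : F x :=
  i x ((v : dsum _) true : P x) + ker_incl p x ((v : dsum _) false : Q x).

Let to_linear x : linear (@to_fun x).
Proof.
move=> c v w; rewrite /to_fun.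
have E b : ((c *: v + w : S x) : dsum _) b = c *: (v : dsum _) b + (w : dsum _) b by [].
by rewrite !E !linearP /= scalerDr addrACA.
Qed.
HB.instance Definition _ x := GRing.isLinear.Build K (S x) (F x) _ (@to_fun x) (@to_linear x).

Let to_nat x y (u : hom x y) v : to_fun (cmod_map S u v) = cmod_map F u (to_fun v).
Proof. by rewrite /to_fun linearD -!cmod_hom_nat. Qed.

Let rest_subproof x (w : F x) : w - i x (p x w) \in @ker_pred K G F P p x.
Proof. by rewrite unfold_in linearB /= ipK subrr. Qed.

Let from_fun x (w : F x) : S x :=
  @DSum K bool (fun b : bool => (if b then P else Q) x)
    (fun b => match b return (if b then P else Q) x with
       | true => p x w
       | false => exist _ (w - i x (p x w)) (rest_subproof w) : ker_ob p x
     end) finite_finset.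

Let from_linear x : linear (@from_fun x).
Proof.
move=> c v w; apply: dsum_ext => -[]; first by rewrite /= linearP.
by apply: val_inj; rewrite /= (linearP (p x)) (linearP (i x)) opprD addrACA scalerBr.
Qed.
HB.instance Definition _ x := GRing.isLinear.Build K (F x) (S x) _ (@from_fun x) (@from_linear x).

Let from_nat x y (u : hom x y) v : from_fun (cmod_map F u v) = cmod_map S u (from_fun v).
Proof.
apply: dsum_ext => -[]; first by rewrite /= cmod_hom_nat.
by apply: val_inj; rewrite /= linearB !cmod_hom_nat.
Qed.

Lemma retract_summand : exists Q : cmod K G, cmod_iso (cmod_sum2 P Q) F.
Proof.
exists Q, (@CModHom K G S F (fun x => @to_fun x) (fun x y u v => to_nat u v)).
exists (@CModHom K G F S (fun x => @from_fun x) (fun x y u v => from_nat u v)).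
move=> x; split=> [v|w]; last by rewrite /= /to_fun /= addrC subrK.
have pv : p x (to_fun v) = (v : dsum _) true :> P x.
  by rewrite /to_fun linearD ipK /= (@ker_obP _ _ _ _ p x ((v : dsum _) false : Q x)) addr0.
apply: dsum_ext => -[]; first exact: pv.
by apply: val_inj; rewrite /= pv /to_fun addrAC subrr add0r.
Qed.

End RetractSummand.

(** * Finite-dimensional spaces *)

Section FiniteDimension.
Variable K : fieldType.

Definition findim (V : lmodType K) := fdim [set: V] [set 0].

Lemma findim_row n : findim 'rV[K]_n.
Proof.
exists n, (fun i => delta_mx ord0 i).
have E (c : 'rV[K]_n) : lincomb (fun i => delta_mx ord0 i) c = c.
  by rewrite [RHS]row_sum_delta.
by split=> // [v _|c]; [exists v; rewrite E subrr|rewrite E].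
Qed.

Lemma findim_inj (V W : lmodType K) (f : {linear V -> W}) :
  (forall v, f v = 0 -> v = 0) -> findim W -> findim V.
Proof.
move=> fI fW; pose Y := [set w | exists v, f v = w].
have sY : subspace Y.
  split=> [|c _ _ [v <-] [w <-]]; first by exists 0; rewrite linear0.
  by exists (c *: v + w); rewrite linearP.
apply/(fdim_iso (f := f) (Y' := Y) (subspace_zero _) (subspaceT _) sY).
  split=> [v _|v ->|v _ /fI|_ [v <-]]; rewrite /= ?linear0//; first by exists v.
  by exists v => //; rewrite subrr.
by apply: fdim_sub fW => //; exact: subspace_zero.
Qed.

Record coordinates (V : lmodType K) := Coordinates {
  cdim : nat;
  cbasis : 'I_cdim -> V;
  ccoord : {linear V -> 'rV[K]_cdim};
  ccoordK : forall v, v = lincomb cbasis (ccoord v) }.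

Lemma findim_coord (V : lmodType K) : findim V -> exists c : coordinates V, True.
Proof.
move=> [n [b [_ sb ib]]].
have /choice[s sE] v : exists c, v = lincomb b c.
  by have [//|c /eqP] := sb v; rewrite subr_eq0 => /eqP; exists c.
have s_lin : linear s.
  move=> c v w; apply/eqP; rewrite -subr_eq0; apply/eqP; apply: ib.
  by rewrite linearB linearP /= -!sE subrr.
pose s' : {linear V -> 'rV[K]_n} := HB.pack s (GRing.isLinear.Build K _ _ _ s s_lin).
by exists (@Coordinates V n b s' sE).
Qed.

End FiniteDimension.

(** * Averaged induction from the automorphism groups *)

Section Families.
Variables (K : fieldType) (G : category) (M : cmod K G).

Section Object.
Variable z : G.

Definition family : lmodType K := dsum (fun t : {x : G & hom z x} => M (tag t)).

(** Families phi that are invariant under the action of aut(x) on M(x) (x) K mor(z,x).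
    When |aut(x)| is invertible, the invariants form a direct summand, isomorphic to
    the tensor product of M(x) with K mor(z,x) over the group algebra. *)
Definition equivariant (phi : forall x, hom z x -> M x) : Prop :=
  forall x (u : hom z x) (a : hom x x), cmod_map M a (phi x (hcomp a u)) = phi x u.

Definition fam_at (phi : family) x (u : hom z x) : M x :=
  (phi : dsum _) (existT (fun x => hom z x) x u).

Definition equiv_pred : {pred family} := fun phi => `[< equivariant (fam_at phi) >].

Lemma equiv_pred_closed : submod_closed equiv_pred.
Proof.
split=> [|c v w /asboolP v_eq /asboolP w_eq]; apply/asboolP => x u a.
  exact: linear0.
have E y (f : hom z y) : fam_at (c *: v + w) f = c *: fam_at v f + fam_at w f by [].
by rewrite !E linearP v_eq w_eq.
Qed.
HB.instance Definition _ := GRing.isSubmodClosed.Build K family equiv_pred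
  equiv_pred_closed.

Definition eqfam := {phi : family | phi \in equiv_pred}.
HB.instance Definition _ := SubChoice.on eqfam.
HB.instance Definition _ := [SubChoice_isSubLmodule of eqfam by <:].

Definition ev x (u : hom z x) (phi : eqfam) : M x := fam_at (val phi) u.

Lemma ev_is_linear x (u : hom z x) : linear (ev u).
Proof. by []. Qed.
HB.instance Definition _ x (u : hom z x) := GRing.isLinear.Build K eqfam (M x) _
  (ev u) (ev_is_linear u).

Lemma ev_equivariant (phi : eqfam) : equivariant (fun x u => ev u phi).
Proof. exact/asboolP/(valP phi). Qed.

Lemma eqfam_ext (phi psi : eqfam) : (forall x (u : hom z x), ev u phi = ev u psi) -> phi = psi.
Proof. by move=> E; apply/val_inj/dsum_ext => -[x u]; exact: E. Qed.

End Object.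

Hypotheses (EI : EI_cat G) (skel : skeletal G).
Hypotheses (fin_ob : finite_set [set: G])
  (fin_hom : forall x y : G, finite_set [set: hom x y]).
Local Notation obF := (finof fin_ob).
Local Notation homF x y := (finof (fin_hom x y)).

Section Make.
Variables (z : G) (phi : forall x, hom z x -> M x).
Hypothesis phi_eq : equivariant phi.

Definition mkfam : family z :=
  @DSum K {x : G & hom z x} (fun t => M (tag t)) (fun t => phi (tagged t))
    (@finite_finset (arrow_fin fin_ob fin_hom z) _).

Lemma mkfam_subproof : mkfam \in @equiv_pred z.
Proof. exact/asboolP. Qed.

Definition mkeqfam : eqfam z := exist _ mkfam mkfam_subproof.

End Make.

Section Push.
Variables (z z' : G) (f : hom z' z) (phi : eqfam z).

(** The functoriality of z |-> M(x) (x) K mor(z,x), where composition with f moves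
    the coefficient of w to w o f. *)
Definition push_fun x (u : hom z' x) : M x :=
  \sum_(w : homF z x | hcomp w f == u) ev w phi.

Lemma push_fun_equivariant : equivariant push_fun.
Proof.
move=> x u a; have [b [ba ab]] := EI a; rewrite /push_fun linear_sum /=.
rewrite (reindex (fun w : homF z x => hcomp a w : homF z x)) /=; last first.
  by exists (fun w : homF z x => hcomp b w : homF z x) => w _;
    rewrite hcompA ?ba ?ab hcomp1f.
apply: eq_big => [w|w _]; last exact: ev_equivariant.
apply/eqP/eqP => [/(congr1 (hcomp b))|<-]; last by rewrite hcompA.
by rewrite !hcompA ba !hcomp1f.
Qed.

Definition push : eqfam z' := mkeqfam push_fun_equivariant.
Lemma pushE x (u : hom z' x) :
  ev u push = \sum_(w : homF z x | hcomp w f == u) ev w phi.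
Proof. by []. Qed.
End Push.

Lemma push_is_linear z z' (f : hom z' z) : linear (push f).
Proof.
move=> c v w; apply: eqfam_ext => x u; rewrite linearP /= !pushE.
rewrite scaler_sumr -big_split; apply: eq_bigr => g _ /=; exact: linearP.
Qed.
HB.instance Definition _ z z' (f : hom z' z) := GRing.isLinear.Build K (eqfam z) (eqfam z') _
  (push f) (push_is_linear f).

Lemma push_id z (phi : eqfam z) : push (idm z) phi = phi.
Proof.
apply: eqfam_ext => x u; rewrite pushE.
under eq_bigl do rewrite hcompf1.
by rewrite (big_pred1 (u : homF z x)).
Qed.

Lemma push_comp x y z (g : hom y z) (f : hom x y) (phi : eqfam z) :
  push (hcomp g f) phi = push f (push g phi).
Proof.
apply: eqfam_ext => t u; rewrite !pushE.
rewrite (partition_big (fun w : homF z t => hcomp w g : homF y t)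
  (fun w' : homF y t => hcomp w' f == u)) /=; last by move=> w; rewrite hcompA.
apply: eq_bigr => w' /eqP w'f; rewrite pushE; apply: eq_bigl => w.
by case: (hcomp w g =P w') => [wg|]; rewrite ?andbF// andbT hcompA wg w'f eqxx.
Qed.

Definition ind_cmod : cmod K G :=
  @CMod K G (fun z => eqfam z : lmodType K)
    (fun x y u => push u : {linear eqfam y -> eqfam x}) push_id push_comp.

Hypothesis char0 : forall n, n.+1%:R != 0 :> K.

(** The weight 1/|aut(x)| compensates the sums over aut(x)-orbits, all of whose
    members contribute equally. *)
Definition aut_weight (x : G) : K := #|homF x x|%:R^-1.

Lemma aut_weightK (x : G) : #|homF x x|%:R * aut_weight x = 1.
Proof.
rewrite divff//; have := card_endo_gt0 fin_hom x.
by case: #|homF x x| => // n _.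
Qed.

Lemma card_weight (V : lmodType K) (x : G) (v : V) :
  aut_weight x *: \sum_(a : homF x x) v = v.
Proof.
rewrite sumr_const -scaler_nat scalerA mulrC aut_weightK; exact: scale1r.
Qed.

Definition counit z (phi : eqfam z) : M z :=
  \sum_(x : obF) aut_weight x *: \sum_(u : homF z x) cmod_map M u (ev u phi).

Lemma counit_is_linear z : linear (@counit z).
Proof.
move=> c v w; rewrite /counit scaler_sumr -big_split; apply: eq_bigr => x _ /=.
rewrite scalerA [c * _]mulrC -scalerA -scalerDr; congr (_ *: _).
rewrite scaler_sumr -big_split; apply: eq_bigr => u _ /=.
by rewrite !linearP.
Qed.
HB.instance Definition _ z := GRing.isLinear.Build K (eqfam z) (M z) _
  (@counit z) (@counit_is_linear z).

Lemma counit_nat x y (f : hom x y) (phi : eqfam y) :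
  counit (push f phi) = cmod_map M f (counit phi).
Proof.
rewrite /counit linear_sum; apply: eq_bigr => t _ /=.
rewrite [RHS]linearZ_LR [in RHS]linear_sum /=; congr (_ *: _).
rewrite [RHS](partition_big (fun w : homF y t => hcomp w f : homF x t) xpredT)//=.
apply: eq_bigr => u _; rewrite pushE linear_sum; apply: eq_bigr => w /eqP <-.
by rewrite cmod_map_comp.
Qed.

Definition counit_hom : cmod_hom ind_cmod M :=
  @CModHom K G ind_cmod M (fun z => @counit z : {linear eqfam z -> M z}) counit_nat.

(** The pullback along u of the equivariant family that is supported on the
    isomorphisms out of x and has the value m at the identity of x. Summing over the
    isomorphisms g from y to x makes the definition uniform in y, without transport
    along y = x. *)
Section Delta.
Variables (z x : G) (u : hom z x) (m : M x).

Definition delta_fun y (w : hom z y) : M y :=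
  \sum_(g : homF y x | `[< is_iso (g : hom y x) >] && (hcomp g w == u)) cmod_map M g m.

Lemma delta_fun_equivariant : equivariant delta_fun.
Proof.
move=> y w a; have [b [ba ab]] := EI a; rewrite /delta_fun linear_sum /=.
rewrite [RHS](reindex (fun g : homF y x => hcomp g a : homF y x)) /=; last first.
  by exists (fun g : homF y x => hcomp g b : homF y x) => g _;
    rewrite -hcompA ?ba ?ab hcompf1.
apply: eq_big => [g|g _]; last by rewrite cmod_map_comp.
rewrite hcompA; congr (_ && _); apply/asboolP/asboolP => [gi|gi].
  by apply: is_iso_comp => //; exact: EI.
rewrite -[g]hcompf1 -ab hcompA; apply: is_iso_comp => //; exact: EI.
Qed.

Definition delta : eqfam z := mkeqfam delta_fun_equivariant.

Lemma deltaE y (w : hom z y) : ev w delta =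
  \sum_(g : homF y x | `[< is_iso (g : hom y x) >] && (hcomp g w == u)) cmod_map M g m.
Proof. by []. Qed.

Lemma delta_neq y (w : hom z y) : y <> x -> ev w delta = 0.
Proof.
move=> yx; rewrite deltaE big_pred0// => g; apply/andP => -[/asboolP gi _].
by apply: yx; apply: skel; exists g.
Qed.

Lemma delta_eq (w : hom z x) : ev w delta =
  \sum_(g : homF x x | hcomp g w == u) cmod_map M g m.
Proof.
rewrite deltaE; apply: eq_bigl => g; rewrite andb_idl// => _.
by apply/asboolP; exact: EI.
Qed.
End Delta.

Lemma delta_is_linear z x (u : hom z x) : linear (delta u).
Proof.
move=> c v w; apply: eqfam_ext => y t; rewrite linearP /= !deltaE.
rewrite scaler_sumr -big_split; apply: eq_bigr => g _ /=; exact: linearP.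
Qed.
HB.instance Definition _ z x (u : hom z x) := GRing.isLinear.Build K (M x) (eqfam z) _
  (delta u) (delta_is_linear u).

Lemma push_delta z z' x (f : hom z' z) (u : hom z x) m :
  push f (delta u m) = delta (hcomp u f) m.
Proof.
apply: eqfam_ext => y t; rewrite pushE deltaE.
under eq_bigr do rewrite deltaE.
rewrite (exchange_big_dep (fun g : homF y x =>
  `[< is_iso (g : hom y x) >] && (hcomp g t == hcomp u f)))/=.
  apply: eq_bigr => g /andP[/asboolP gi /eqP gt]; have [h [hg gh]] := gi.
  rewrite (big_pred1 (hcomp h u : homF z y))// => w /=.
  apply/andP/eqP => [[/eqP _ /andP[_ /eqP <-]]|->]; first by rewrite hcompA hg hcomp1f.
  split; first by rewrite -hcompA -gt hcompA hg hcomp1f.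
  by rewrite hcompA gh hcomp1f eqxx andbT; exact/asboolP.
by move=> w g /eqP <- /andP[-> /eqP <-]; rewrite hcompA eqxx.
Qed.

Lemma counit_delta z x (u : hom z x) m : counit (delta u m) = cmod_map M u m.
Proof.
rewrite /counit (bigD1 (x : obF))//= [X in _ + X]big1 ?addr0; last first.
  move=> y /eqP yx; rewrite big1 ?scaler0// => w _.
  by rewrite delta_neq// linear0.
under eq_bigr do rewrite delta_eq linear_sum.
rewrite (exchange_big_dep xpredT)//= -[RHS](card_weight x); congr (_ *: _).
apply: eq_bigr => g _; have [h [hg gh]] := EI (g : hom x x).
rewrite (big_pred1 (hcomp h u : homF z x)) => [|w].
  by rewrite -cmod_map_comp hcompA gh hcomp1f.
apply/eqP/eqP => [<-|->]; first by rewrite hcompA hg hcomp1f.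
by rewrite hcompA gh hcomp1f.
Qed.

Lemma counit_surj z (v : M z) : exists phi, counit phi = v.
Proof. by exists (delta (idm z) v); rewrite counit_delta cmod_map_id. Qed.

(** At a given w, the |aut(y)| terms that contribute agree by equivariance. This is
    the identity that splits the cover of the
    induced module by representables. *)
Lemma eqfam_sum_delta z (phi : eqfam z) :
  \sum_(x : obF) aut_weight x *: \sum_(u : homF z x) delta u (ev u phi) = phi.
Proof.
apply: eqfam_ext => y w; rewrite linear_sum /= (bigD1 (y : obF))//=.
rewrite [X in _ + X]big1 ?addr0; last first.
  move=> x /eqP xy; rewrite linearZ_LR linear_sum /= big1 ?scaler0// => u _.
  by rewrite delta_neq// => yx; apply: xy.
rewrite linearZ_LR linear_sum /=.
under eq_bigr do rewrite delta_eq.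
rewrite (exchange_big_dep xpredT)//= -[RHS](card_weight y); congr (_ *: _).
apply: eq_bigr => g _.
rewrite (big_pred1 (hcomp g w : homF z y)); last by move=> u; rewrite /= eq_sym.
exact: ev_equivariant.
Qed.

(** If M vanishes at all x <> z with mor(z,x) nonempty, then only the component of
    phi at x = z is left; it is determined by its value at the identity, which is the
    value of the counit. *)
Lemma counit_inj z (phi : eqfam z) :
  (forall x (u : hom z x), x <> z -> forall v : M x, v = 0) -> counit phi = 0 -> phi = 0.
Proof.
move=> M0 phi0.
have ev_id (u : hom z z) : cmod_map M u (ev u phi) = ev (idm z) phi.
  by rewrite -[RHS](ev_equivariant phi (idm z) u) hcompf1.
have id0 : ev (idm z) phi = 0.
  rewrite -phi0 /counit (bigD1 (z : obF))//= [X in _ + X]big1 ?addr0; last first.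
    move=> y /eqP yz; rewrite big1 ?scaler0// => w _.
    by rewrite (M0 y w yz (ev w phi)) linear0.
  by under eq_bigr do rewrite ev_id; rewrite card_weight.
apply: eqfam_ext => x u; rewrite linear0.
have [xz|] := pselect (x = z); last by move=> xz; exact: (M0 x u xz).
subst x; have [w [wu uw]] := EI u.
by rewrite -[LHS](cmod_map_id (c := M)) -uw cmod_map_comp ev_id id0 linear0.
Qed.

Variable co : forall x, coordinates (M x).

Let J : finType := {x : obF & 'I_(cdim (co x))}.
Let xj (j : 'I_#|J|) : G := tag (enum_val j).
Let bj j : M (xj j) := cbasis (tagged (enum_val j)).
Let cj j (v : M (xj j)) : K := ccoord (co (xj j)) v ord0 (tagged (enum_val j)).
Let Free := cmod_dsum (fun j => repr_cmod K (xj j)).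

Let lift_delta z j : {linear {freeg (hom z (xj j)) / K} -> eqfam z} :=
  fglift (fun u => delta u (bj j)).

Let lift_deltaU z j (u : hom z (xj j)) : lift_delta z j << u >> = delta u (bj j).
Proof. by rewrite /lift_delta /= liftU scale1r. Qed.

(* [Free] has one summand K mor(?,x) for each vector b of a basis of M(x); its generator
   goes to the family [delta (idm x) b], and [split_fun] expands the values of an
   equivariant family in these bases. *)
Let cover z (v : Free z) : eqfam z := \sum_j lift_delta z j ((v : dsum _) j).

Let cover_is_linear z : linear (@cover z).
Proof.
move=> c v w; rewrite /cover scaler_sumr -big_split; apply: eq_bigr => j _ /=.
exact: linearP.
Qed.
HB.instance Definition _ z := GRing.isLinear.Build K (Free z) (eqfam z) _
  (@cover z) (@cover_is_linear z).

Let cover_nat x y (f : hom x y) (v : Free y) :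
  cover (cmod_map Free f v) = push f (cover v).
Proof.
rewrite /cover linear_sum; apply: eq_bigr => j _.
pose u : {freeg (hom y (xj j)) / K} := (v : dsum _) j.
apply: (@freeg_linear_ext K _ _
  (lift_delta x j \o cmod_map (repr_cmod K (xj j)) f) (push f \o lift_delta y j) _ u) => s.
transitivity (lift_delta x j << hcomp s f >>).
  exact: (congr1 (lift_delta x j) (freeg_mapU K (fun u : hom y (xj j) => hcomp u f) s)).
by rewrite lift_deltaU -push_delta -lift_deltaU.
Qed.

Let split_fun z (phi : eqfam z) : Free z :=
  @DSum K _ (fun j => repr_cmod K (xj j) z)
    (fun j => \sum_(u : homF z (xj j))
      (aut_weight (xj j) * cj (ev u phi)) *: << u : hom z (xj j) >>)
    finite_finset.

Let split_is_linear z : linear (@split_fun z).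
Proof.
move=> c v w; apply: dsum_ext => j.
transitivity (c *: ((split_fun v : dsum _) j) + (split_fun w : dsum _) j) => //.
rewrite /= scaler_sumr -big_split; apply: eq_bigr => u _ /=.
rewrite scalerA -scalerDl; congr (_ *: _).
by rewrite /cj linearP !mxE mulrDr mulrCA.
Qed.
HB.instance Definition _ z := GRing.isLinear.Build K (eqfam z) (Free z) _
  (@split_fun z) (@split_is_linear z).

Let split_nat x y (f : hom x y) (phi : eqfam y) :
  split_fun (push f phi) = cmod_map Free f (split_fun phi).
Proof.
apply: dsum_ext => j.
transitivity (cmod_map (repr_cmod K (xj j)) f ((split_fun phi : dsum _) j)) => //.
rewrite [((split_fun _ : dsum _) j)]/= linear_sum.
rewrite [RHS](partition_big (fun w : homF y (xj j) => hcomp w f : homF x (xj j)) xpredT)//=.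
apply: eq_bigr => u _; rewrite pushE /cj linear_sum /= summxE mulr_sumr scaler_suml.
apply: eq_bigr => w /eqP <-; rewrite [RHS]linearZ_LR; congr (_ *: _).
by rewrite [RHS]freeg_mapU.
Qed.

Lemma cover_split z (phi : eqfam z) : cover (split_fun phi) = phi.
Proof.
rewrite -[RHS]eqfam_sum_delta.
transitivity (\sum_(j < #|J|) \sum_(u : homF z (xj j))
   aut_weight (xj j) *: delta u (cj (ev u phi) *: bj j)).
  rewrite /cover; apply: eq_bigr => j _; rewrite linear_sum; apply: eq_bigr => u _.
  by rewrite [LHS]linearZ_LR lift_deltaU [X in _ = _ *: X]linearZ_LR scalerA.
pose F (t : J) := \sum_(u : homF z (tag t)) aut_weight (tag t) *:
  delta u (ccoord (co (tag t)) (ev u phi) ord0 (tagged t) *: cbasis (tagged t)).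
transitivity (\sum_(t : J) F t).
  by rewrite [RHS](reindex (@enum_val J predT)) //; exact: onW_bij (enum_val_bij _).
rewrite -(@sig_big_dep _ _ _ _ _ xpredT (fun _ _ => true) (fun (x : obF) (k : 'I_(cdim (co x))) =>
  \sum_(u : homF z x) aut_weight x *:
  delta u (ccoord (co x) (ev u phi) ord0 k *: cbasis k)))/=.
apply: eq_bigr => x _; rewrite exchange_big scaler_sumr; apply: eq_bigr => u _ /=.
rewrite -scaler_sumr -linear_sum; congr (_ *: delta u _).
by rewrite [RHS](ccoordK (co x)).
Qed.

Lemma ind_fg_projective : fg_projective ind_cmod.
Proof.
exists #|J|, xj.
apply: (@retract_summand K G ind_cmod Free
  (@CModHom K G ind_cmod Free (fun z => @split_fun z : {linear eqfam z -> Free z}) split_nat)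
  (@CModHom K G Free ind_cmod (fun z => @cover z : {linear Free z -> eqfam z}) cover_nat)).
exact: cover_split.
Qed.

Lemma ind_findim z : findim (ind_cmod z).
Proof.
pose T : finType := {j : 'I_#|J| & homF z (xj j)}.
pose s (phi : eqfam z) : 'rV[K]_#|T| :=
  \row_i let t := @enum_val T predT i in cj (ev (tagged t : hom z (xj (tag t))) phi).
have s_lin : linear s.
  by move=> c v w; apply/rowP => i; rewrite !mxE /cj !linearP /= !mxE.
pose s' : {linear eqfam z -> 'rV[K]_#|T|} :=
  HB.pack s (GRing.isLinear.Build K _ _ _ s s_lin).
apply: (findim_inj (f := s')) (findim_row _ _) => phi phi0.
rewrite -[phi]cover_split -[RHS](linear0 (@cover z)); congr cover.
apply: dsum_ext => j /=; apply: big1 => u _.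
have /rowP/(_ (enum_rank (Tagged (fun j => homF z (xj j)) u : T))) := phi0.
rewrite !mxE enum_rankK /= => ->.
by rewrite mulr0 scale0r.
Qed.

End Families.

(** * A finite resolution of the constant module *)

Section FiniteResolution.
Variables (K : fieldType) (G : category).
Hypothesis char0 : forall n, n.+1%:R != 0 :> K.
Hypotheses (EI : EI_cat G) (skel : skeletal G).
Hypotheses (fin_ob : finite_set [set: G])
  (fin_hom : forall x y : G, finite_set [set: hom x y]).

Let ind (M : cmod K G) : cmod K G := ind_cmod M EI fin_ob fin_hom.
Let eps (M : cmod K G) : cmod_hom (ind M) M := counit_hom M EI fin_ob fin_hom.

Fixpoint syzygy (n : nat) : cmod K G :=
  if n is n'.+1 then ker_cmod (eps (syzygy n')) else const_cmod K G.

Let d n : cmod_hom (ind (syzygy n.+1)) (ind (syzygy n)) :=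
  comp_hom (ker_incl (eps (syzygy n))) (eps (syzygy n.+1)).

Let eps_surj (M : cmod K G) x (v : M x) : exists u, eps M x u = v.
Proof. exact: counit_surj. Qed.

Let d0 n x (u : ind (syzygy n) x) :
  eps (syzygy n) x u = 0 <-> exists w, d n x w = u.
Proof.
split=> [eu|[w <-]]; last exact: ker_obP.
pose u' : syzygy n.+1 x := exist _ u (introT eqP eu).
by have [w wE] := eps_surj u'; exists w; rewrite /d /= wE.
Qed.

Let dS n x (u : ind (syzygy n.+1) x) :
  d n x u = 0 <-> exists w, d n.+1 x w = u.
Proof.
rewrite -d0; split=> [du|eu]; first exact: val_inj.
by rewrite /d /= eu.
Qed.

Definition syzygy_resolution : resolution (const_cmod K G) :=
  @Resolution K G (const_cmod K G) (fun n => ind (syzygy n)) d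
    (eps (const_cmod K G)) (@eps_surj _) (@d0 0) dS.

Lemma syzygy_findim n x : findim (syzygy n x).
Proof.
elim: n x => [|n IH] x.
  exists 1%N, (fun=> 1 : K^o); split=> // [v _|c].
    by exists (const_mx (v : K)); rewrite /lincomb big_ord1 mxE [_ *: _]mulr1 subrr.
  rewrite /lincomb big_ord1 [_ *: _]mulr1 => c0; apply/rowP => i.
  by rewrite ord1 mxE.
have co y : coordinates (syzygy n y) := sval (cid (findim_coord (IH y))).
apply: (findim_inj (f := (val : {linear ker_ob (eps (syzygy n)) x -> ind (syzygy n) x}))).
  by move=> v v0; apply: val_inj.
exact: ind_findim.
Qed.

Lemma syzygy_fg_projective n : fg_projective (ind (syzygy n)).
Proof.
have co y : coordinates (syzygy n y) := sval (cid (findim_coord (syzygy_findim n y))).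
exact: ind_fg_projective.
Qed.

(** Every step kills the objects of the least height that are left, by
    [counit_inj]; so the resolution is no longer than the number of objects. *)
Lemma syzygy_vanish n x (v : syzygy n x) : (height fin_ob x <= n)%N -> v = 0.
Proof.
elim: n x v => [|n IH] x v hx.
  have : (0 < height fin_ob x)%N.
    by apply/card_gt0P; exists (x : finof fin_ob); rewrite inE; apply/asboolP; exists; exact: idm.
  by rewrite ltnNge hx.
suff v0 : val v = 0 :> ind (syzygy n) x by apply: val_inj.
apply: (counit_inj EI (fin_ob := fin_ob) (fin_hom := fin_hom) char0) => [y u yx w|].
  apply: IH; rewrite -ltnS; apply: leq_trans hx.
  by apply: (height_neq EI skel fin_ob u) => xy; apply: yx.
exact: (@ker_obP _ _ _ _ (eps (syzygy n)) x v).
Qed.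

Lemma finite_type_FP : type_FP K G.
Proof.
exists syzygy_resolution; split; first exact: syzygy_fg_projective.
exists #|finof fin_ob|; move=> p x np v.
apply: eqfam_ext => y u; rewrite linear0; apply: syzygy_vanish.
by apply: leq_trans np; exact: max_card.
Qed.

End FiniteResolution.

Lemma fg_projective_projective (K : fieldType) (G : category) (P : cmod K G) :
  fg_projective P -> projective P.
Proof. by move=> [n [x [Q PQ]]]; exists 'I_n, x, Q. Qed.

Theorem lemma7p3 (R : realType) (Gamma : category)
    (Gamma_finite : finite_cat Gamma) (Gamma_free : free_cat Gamma)
    (Gamma_EI : EI_cat Gamma) (Gamma_skeletal : skeletal Gamma) :
  [/\ type_FP R[i] Gamma,
      type_L2 R[i] Gamma R,
      has_chiL Gamma &
      chi2 R[i] Gamma R = ratr (chiL Gamma)].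
Proof.
have char0 n : n.+1%:R != 0 :> R[i] by rewrite pnatr_eq0.
have fin_ob := skeletal_finite_ob Gamma_skeletal Gamma_finite.
have FP := finite_type_FP char0 Gamma_EI Gamma_skeletal fin_ob Gamma_finite.2.
have anyP (P : resolution (const_cmod R[i] Gamma)) :=
  L2_any_resolution R Gamma_EI Gamma_free Gamma_skeletal Gamma_finite (P := P).
have [P [fgP _]] := FP.
have projP : projective_resolution P by move=> p; exact/fg_projective_projective.
have [finP weight chiP] := anyP P projP.
split=> //.
- by exists P.
- by split=> //; exact: (exists_coweighting Gamma_EI Gamma_skeletal fin_ob Gamma_finite.2).
- rewrite /chi2; case: xgetP => [_ -> [P' [projP' _ ->]]|].
    by have [] := anyP P' projP'.
  by move=> /(_ (L2_alt_sum R P)); case; exists P.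
Qed.
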